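(* Let $(\mathscr{A},\mathscr{B},\mathscr{C})$ be a recollement of abelian categories, with functors $\mathsf{i}:\mathscr{A}\to\mathscr{B}$, $\mathsf{q},\mathsf{p}:\mathscr{B}\to\mathscr{A}$, $\mathsf{e}:\mathscr{B}\to\mathscr{C}$, $\mathsf{l},\mathsf{r}:\mathscr{C}\to\mathscr{B}$, and suppose that $\mathsf{Proj}\,\mathscr{B}=\mathrm{add}(P)$ for some projective object $P$ of $\mathscr{B}$. Assume that $\mathsf{l}$ is exact. (1) If $\mathsf{gl.dim}_{\mathscr{A}}\mathscr{B}<\infty$, then $$\mathrm{IT.dist}(\mathscr{C})\le \mathrm{IT.dist}(\mathscr{B})\le \mathrm{IT.dist}(\mathscr{C})+2.$$ Moreover, if $\mathsf{q}$ is also exact, then $$\mathrm{IT.dist}(\mathscr{C})\le \mathrm{IT.dist}(\mathscr{B})\le \mathrm{IT.dist}(\mathscr{C})+1.$$ (2) If $\mathsf{p}$ is exact, then $$\mathrm{IT.dist}(\mathscr{C})\le \mathrm{IT.dist}(\mathscr{B})\le 2\,\mathrm{IT.dist}(\mathscr{A})+\mathrm{IT.dist}(\mathscr{C})+2.$$ Moreover, if $\mathsf{q}$ is also exact, then $$\mathrm{IT.dist}(\mathscr{C})\le \mathrm{IT.dist}(\mathscr{B})\le \mathrm{IT.dist}(\mathscr{A})+\mathrm{IT.dist}(\mathscr{C})+1.$$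
   Context: All abelian categories are assumed to have enough projectives. For an abelian category $\mathscr{D}$, $\mathsf{Proj}\,\mathscr{D}$ is the full subcategory of projective objects, and for an object $U$, $\mathrm{add}(U)$ is the subcategory of direct summands of finite direct sums of copies of $U$. Recollement: a recollement $(\mathscr{A},\mathscr{B},\mathscr{C})$ of abelian categories consists of functors $\mathsf{i}:\mathscr{A}\to\mathscr{B}$, $\mathsf{q},\mathsf{p}:\mathscr{B}\to\mathscr{A}$, $\mathsf{e}:\mathscr{B}\to\mathscr{C}$, $\mathsf{l},\mathsf{r}:\mathscr{C}\to\mathscr{B}$ such that $(\mathsf{l},\mathsf{e},\mathsf{r})$ and $(\mathsf{q},\mathsf{i},\mathsf{p})$ are adjoint triples (each functor is left adjoint to the next), $\mathsf{i},\mathsf{l},\mathsf{r}$ are fully faithful, and $\mathrm{Im}\,\mathsf{i}=\mathrm{Ker}\,\mathsf{e}$ (the essential image of $\mathsf i$ is the class of objects killed by $\mathsf e$). Relative global dimension: $\mathsf{gl.dim}_{\mathscr{A}}\mathscr{B}:=\sup\{\mathsf{pd}_{\mathscr{B}}\,\mathsf{i}(A)\mid A\in\mathscr{A}\}$, where $\mathsf{pd}_{\mathscr B}$ is projective dimension in $\mathscr{B}$. Syzygies: for $n\ge 1$, an object $K$ is an $n$-syzygy object of $X$ if there is an exact sequence $0\to K\to P_{n-1}\to\cdots\to P_0\to X\to 0$ with all $P_i$ projective; the $0$-syzygy of $X$ is $X$. $\Omega^n(\mathscr{D})$ denotes the subcategory of all $n$-syzygy objects of objects of $\mathscr{D}$.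 Igusa--Todorov category and distance: for nonnegative integers $m,n$, an abelian category $\mathscr{D}$ is an $(m,n)$-Igusa--Todorov category if there is an object $U\in\mathscr{D}$ such that for every $D\in\Omega^n(\mathscr{D})$ there is an exact sequence $0\to U_m\to U_{m-1}\to\cdots\to U_0\to D\to 0$ with $U_i\in\mathrm{add}(U)$ for $0\le i\le m$. The Igusa--Todorov distance is $$\mathrm{IT.dist}(\mathscr{D}):=\inf\{m\mid \mathscr{D}\text{ is an }(m,n)\text{-Igusa--Todorov category for some nonnegative integer }n\},$$ with $\inf\emptyset=\infty$. *)

(* Defs.v *)
From HB Require Import structures.
From mathcomp Require Import all_boot all_order all_algebra.
From mathcomp Require Import classical_sets reals constructive_ereal ereal.

Set Implicit Arguments.
Unset Strict Implicit.
Unset Printing Implicit Defensive.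

Import Order.TTheory GRing.Theory Num.Theory.
Local Open Scope ring_scope.

Reserved Notation "g \c f" (at level 40, left associativity).

(** * Preadditive and abelian categories *)

(* Equality of morphisms is Leibniz equality; the choice structure contained in
   a zmodType exists on every type by the axioms of mathcomp.classical.boolp,
   so it does not restrict the categories considered. *)
Record preaddCat := PreaddCat {
  obj :> Type;
  Mor : obj -> obj -> zmodType;
  idmor : forall X, Mor X X;
  compm : forall X Y Z, Mor Y Z -> Mor X Y -> Mor X Z;
  comp1m : forall X Y (f : Mor X Y), compm (idmor Y) f = f;
  compm1 : forall X Y (f : Mor X Y), compm f (idmor X) = f;
  compmA : forall X Y Z W (h : Mor Z W) (g : Mor Y Z) (f : Mor X Y),
    compm h (compm g f) = compm (compm h g) f;
  compmDl : forall X Y Z (g g' : Mor Y Z) (f : Mor X Y),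
    compm (g + g') f = compm g f + compm g' f;
  compmDr : forall X Y Z (g : Mor Y Z) (f f' : Mor X Y),
    compm g (f + f') = compm g f + compm g f'
}.

Arguments Mor {p} X Y : rename.
Arguments idmor {p} X : rename.
Arguments compm {p X Y Z} g f : rename.
Notation "g \c f" := (compm g f).

Section Basics.
Variable D : preaddCat.
Implicit Types X Y Z : D.

Definition mono X Y (f : Mor X Y) : Prop :=
  forall T (g h : Mor T X), f \c g = f \c h -> g = h.

Definition epi X Y (f : Mor X Y) : Prop :=
  forall T (g h : Mor Y T), g \c f = h \c f -> g = h.

Definition isomorphic X Y : Prop :=
  exists (f : Mor X Y) (g : Mor Y X), g \c f = idmor X /\ f \c g = idmor Y.

Definition is_zero X : Prop :=
  forall Y, (forall f : Mor X Y, f = 0) /\ (forall f : Mor Y X, f = 0).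

Definition is_kernel X Y (f : Mor X Y) K (k : Mor K X) : Prop :=
  f \c k = 0 /\
  forall T (h : Mor T X), f \c h = 0 -> exists! u : Mor T K, k \c u = h.

Definition is_cokernel X Y (f : Mor X Y) Q (c : Mor Y Q) : Prop :=
  c \c f = 0 /\
  forall T (h : Mor Y T), h \c f = 0 -> exists! u : Mor Q T, u \c c = h.

(* S is a biproduct of the finite family F. *)
Definition is_dsum (I : finType) (F : I -> D) (S : D) : Prop :=
  exists (inj : forall i, Mor (F i) S) (prj : forall i, Mor S (F i)),
    [/\ forall i, prj i \c inj i = idmor (F i),
        forall i j, i != j -> prj i \c inj j = 0
      & \sum_(i : I) inj i \c prj i = idmor S].

Definition is_dsum2 X Y (S : D) : Prop :=
  is_dsum (fun b : bool => if b then X else Y) S.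

Definition is_image X Y (f : Mor X Y) J (m : Mor J Y) : Prop :=
  exists Q (c : Mor Y Q), is_cokernel f c /\ is_kernel c m.

(* Im f = Ker g, as subobjects of Y *)
Definition exact_at X Y Z (f : Mor X Y) (g : Mor Y Z) : Prop :=
  exists J (m : Mor J Y), is_image f m /\ is_kernel g m.

Definition short_exact X Y Z (f : Mor X Y) (g : Mor Y Z) : Prop :=
  [/\ mono f, exact_at f g & epi g].

Definition projective X : Prop :=
  forall Y Z (g : Mor Y Z) (f : Mor X Z), epi g -> exists h : Mor X Y, g \c h = f.

End Basics.

Record abelianCat (D : preaddCat) : Prop := AbelianCat {
  abelian_zero : exists Z : D, is_zero Z;
  abelian_dsum : forall X Y : D, exists S, is_dsum2 X Y S;
  abelian_ker : forall (X Y : D) (f : Mor X Y), exists K (k : Mor K X), is_kernel f k;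
  abelian_coker : forall (X Y : D) (f : Mor X Y), exists Q (c : Mor Y Q), is_cokernel f c;
  abelian_mono : forall (X Y : D) (f : Mor X Y), mono f ->
    exists Z (g : Mor Y Z), is_kernel g f;
  abelian_epi : forall (X Y : D) (f : Mor X Y), epi f ->
    exists Z (g : Mor Z X), is_cokernel g f
}.

Definition enough_projectives (D : preaddCat) : Prop :=
  forall X : D, exists (P : D) (f : Mor P X), projective P /\ epi f.

(** * Functors, adjunctions, recollements *)

Record functor (C D : preaddCat) := Functor {
  fobj :> C -> D;
  fmor : forall X Y : C, Mor X Y -> Mor (fobj X) (fobj Y);
  fmor1 : forall X : C, fmor (idmor X) = idmor (fobj X);
  fmorM : forall (X Y Z : C) (g : Mor Y Z) (f : Mor X Y),
    fmor (g \c f) = fmor g \c fmor f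
}.

Arguments fmor {C D} F {X Y} f : rename.

(* Additivity is not required: it is automatic for functors having an adjoint,
   hence for the six functors of a recollement. *)
Definition exact_functor (C D : preaddCat) (F : functor C D) : Prop :=
  forall (X Y Z : C) (f : Mor X Y) (g : Mor Y Z),
    short_exact f g -> short_exact (fmor F f) (fmor F g).

Definition fully_faithful (C D : preaddCat) (F : functor C D) : Prop :=
  forall X Y : C, bijective (fun f : Mor X Y => fmor F f).

(* L is left adjoint to G *)
Definition adjoint (C D : preaddCat) (L : functor C D) (G : functor D C) : Prop :=
  exists phi : forall (X : C) (Y : D), Mor (L X) Y -> Mor X (G Y),
    (forall X Y, bijective (@phi X Y)) /\
    (forall (X X' : C) (Y Y' : D) (f : Mor X' X) (h : Mor (L X) Y) (g : Mor Y Y'),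
       phi X' Y' (g \c h \c fmor L f) = fmor G g \c phi X Y h \c f).

Record recollement (A B C : preaddCat) (i : functor A B) (q p : functor B A)
    (e : functor B C) (l r : functor C B) : Prop := Recollement {
  recollement_le : adjoint l e;
  recollement_er : adjoint e r;
  recollement_qi : adjoint q i;
  recollement_ip : adjoint i p;
  recollement_i_ff : fully_faithful i;
  recollement_l_ff : fully_faithful l;
  recollement_r_ff : fully_faithful r;
  recollement_im_ker : forall Y : B, (exists X : A, isomorphic (i X) Y) <-> is_zero (e Y)
}.

(** * add(U), long exact sequences, syzygies *)

Section Homological.
Variable D : preaddCat.

Definition in_add (U X : D) : Prop :=
  exists (n : nat) (S Y : D), is_dsum (fun _ : 'I_n => U) S /\ is_dsum2 X Y S.

(* The sequence 0 -> V m -> ... -> V 1 -> V 0 -> X -> 0, with differentials d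
   and augmentation a, is exact.  It is encoded as an infinite sequence padded
   by zero objects in degrees k > m, so that exactness at V m is exactness of
   0 -> V m -> V m.-1. *)
Definition exact_res (m : nat) (X : D) (V : nat -> D)
    (d : forall k, Mor (V k.+1) (V k)) (a : Mor (V 0%N) X) : Prop :=
  [/\ forall k, (m < k)%N -> is_zero (V k),
      epi a,
      exact_at (d 0%N) a
    & forall k, exact_at (d k.+1) (d k)].

Definition is_syzygy (n : nat) (X K : D) : Prop :=
  if n is 0 then K = X else
  exists (V : nat -> D) (d : forall k, Mor (V k.+1) (V k)) (a : Mor (V 0%N) X),
    [/\ exact_res n d a, forall k, (k < n)%N -> projective (V k) & V n = K].

(* K belongs to Omega^n(D) *)
Definition Omega (n : nat) (K : D) : Prop := exists X : D, is_syzygy n X K.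

Definition has_proj_res (n : nat) (X : D) : Prop :=
  exists (V : nat -> D) (d : forall k, Mor (V k.+1) (V k)) (a : Mor (V 0%N) X),
    exact_res n d a /\ forall k, (k <= n)%N -> projective (V k).

End Homological.

Definition IT_category (m n : nat) (D : preaddCat) : Prop :=
  exists U : D, forall K : D, Omega n K ->
    exists (V : nat -> D) (d : forall k, Mor (V k.+1) (V k)) (a : Mor (V 0%N) K),
      exact_res m d a /\ forall k, (k <= m)%N -> in_add U (V k).

(** * Numerical invariants, with values in the extended reals *)

Section Invariants.
Variable R : realType.
Local Open Scope classical_set_scope.
Local Open Scope ereal_scope.

(* ereal_inf set0 = +oo *)
Definition pd (D : preaddCat) (X : D) : \bar R :=
  ereal_inf [set n%:R%:E | n in [set n : nat | has_proj_res n X]].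

Definition rel_gldim (A B : preaddCat) (i : functor A B) : \bar R :=
  ereal_sup [set pd (i X) | X in [set: A]].

Definition IT_dist (D : preaddCat) : \bar R :=
  ereal_inf [set m%:R%:E | m in [set m : nat | exists n, IT_category m n D]].

End Invariants.

(* Main.v *)
(* Write R(U, m) for the class of objects having an add(U)-resolution of length m.
   If 0 -> X -> Y -> Z -> 0 is exact with X in R(U, a) and Z in R(U, b), then Y is in
   R(U', a + b + 1), where U' adds to U a syzygy and a projective generator: resolve X
   by add(U) and Z by projectives for a + 1 steps, which leaves a syzygy of Z.
   For X in B the counit of (l, e) gives 0 -> Z -> leX -> X -> Q -> 0 with Z and Q in
   the image of i, and Z = 0 when q is exact.  As l is exact and preserves projectives,
   high syzygies of leX are resolved by those of eX.  If J is the image of leX -> X,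
   then 0 -> Omega(leX) -> Omega J -> Z -> 0 and 0 -> J -> X -> Q -> 0, so two
   applications of the extension bound give 2a + c + 2, and one gives a + c + 1 when
   Z = 0.  Here a bounds the resolutions of high syzygies of objects of A in B: a = 0 if
   gl.dim_A B is finite, and a = IT.dist(A) if p is exact, since i then preserves
   projectives.  Since a given syzygy of X need not be the constructed one, R(U, m) has
   to be shown invariant under stable isomorphism (Schanuel's lemma). *)

Require Import Defs.
From mathcomp Require Import all_boot all_order all_algebra.
From mathcomp Require Import boolp classical_sets reals constructive_ereal ereal.

Set Implicit Arguments.
Unset Strict Implicit.
Unset Printing Implicit Defensive.

Import Order.TTheory GRing.Theory Num.Theory.
Local Open Scope ring_scope.

(** * Short exact sequences and resolutions *)

Section Preadditive.
Variable D : preaddCat.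
Implicit Types X Y Z T U : D.

Lemma compm0 X Y Z (g : Mor Y Z) : g \c (0 : Mor X Y) = 0.
Proof. by apply: (addrI (g \c (0 : Mor X Y))); rewrite -compmDr !addr0. Qed.

Lemma comp0m X Y Z (f : Mor X Y) : (0 : Mor Y Z) \c f = 0.
Proof. by apply: (addrI ((0 : Mor Y Z) \c f)); rewrite -compmDl !addr0. Qed.

Lemma compmN X Y Z (g : Mor Y Z) (f : Mor X Y) : g \c (- f) = - (g \c f).
Proof. by apply/eqP; rewrite -addr_eq0 -compmDr addNr compm0. Qed.

Lemma compNm X Y Z (g : Mor Y Z) (f : Mor X Y) : (- g) \c f = - (g \c f).
Proof. by apply/eqP; rewrite -addr_eq0 -compmDl addNr comp0m. Qed.

Lemma compmBr X Y Z (g : Mor Y Z) (f f' : Mor X Y) :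
  g \c (f - f') = g \c f - g \c f'.
Proof. by rewrite compmDr compmN. Qed.

Lemma compmBl X Y Z (g g' : Mor Y Z) (f : Mor X Y) :
  (g - g') \c f = g \c f - g' \c f.
Proof. by rewrite compmDl compNm. Qed.

Lemma compm_sumr X Y Z (I : Type) (s : seq I) (g : Mor Y Z) (f : I -> Mor X Y) :
  g \c (\sum_(j <- s) f j) = \sum_(j <- s) g \c f j.
Proof. by elim: s => [|j s IH]; rewrite ?big_nil ?compm0 // !big_cons compmDr IH. Qed.

Lemma compm_suml X Y Z (I : Type) (s : seq I) (g : I -> Mor Y Z) (f : Mor X Y) :
  (\sum_(j <- s) g j) \c f = \sum_(j <- s) g j \c f.
Proof. by elim: s => [|j s IH]; rewrite ?big_nil ?comp0m // !big_cons compmDl IH. Qed.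

Lemma mono0P X Y (f : Mor X Y) :
  mono f <-> forall T (x : Mor T X), f \c x = 0 -> x = 0.
Proof.
split=> [mf T x fx|mf T g h /eqP]; first by apply: mf; rewrite compm0.
by rewrite -subr_eq0 -compmBr => /eqP/mf/eqP; rewrite subr_eq0 => /eqP.
Qed.

Lemma epi0P X Y (f : Mor X Y) :
  epi f <-> forall T (x : Mor Y T), x \c f = 0 -> x = 0.
Proof.
split=> [ef T x fx|ef T g h /eqP]; first by apply: ef; rewrite comp0m.
by rewrite -subr_eq0 -compmBl => /eqP/ef/eqP; rewrite subr_eq0 => /eqP.
Qed.

Lemma is_zeroP X : idmor X = 0 -> is_zero X.
Proof.
by move=> X0 Y; split=> f; [rewrite -(compm1 f)|rewrite -(comp1m f)];
  rewrite X0 ?compm0 ?comp0m.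
Qed.

Lemma isomorphic_refl X : isomorphic X X.
Proof. by exists (idmor X), (idmor X); rewrite comp1m. Qed.

Lemma isomorphic_sym X Y : isomorphic X Y -> isomorphic Y X.
Proof. by case=> f [g [gf fg]]; exists g, f. Qed.

Definition biproduct X Y S (i1 : Mor X S) (i2 : Mor Y S) (p1 : Mor S X) (p2 : Mor S Y) :=
  [/\ p1 \c i1 = idmor X, p2 \c i2 = idmor Y, p1 \c i2 = 0, p2 \c i1 = 0
    & i1 \c p1 + i2 \c p2 = idmor S].

Lemma is_dsum2P X Y S :
  is_dsum2 X Y S <->
  exists (i1 : Mor X S) (i2 : Mor Y S) (p1 : Mor S X) (p2 : Mor S Y),
    biproduct i1 i2 p1 p2.
Proof.
split.
  move=> [inj [prj [H1 H2 H3]]].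
  exists (inj true), (inj false), (prj true), (prj false).
  rewrite big_bool in H3.
  by split; rewrite ?(H1 true) ?(H1 false) ?(H2 true false) ?(H2 false true).
move=> [i1 [i2 [p1 [p2 [H1 H2 H3 H4 H5]]]]].
exists (fun b => if b return Mor (if b then X else Y) S then i1 else i2).
exists (fun b => if b return Mor S (if b then X else Y) then p1 else p2).
by split; [case|case; case|rewrite big_bool].
Qed.

(* Morphisms factoring through a finite direct sum of copies of U. *)
Definition fadd U X Y (h : Mor X Y) : Prop :=
  exists s : seq (Mor U Y * Mor X U), h = \sum_(p <- s) p.1 \c p.2.

(** Encodes membership in add(U) as being a retract of a finite power of [U], with neither the power
    nor a complement chosen; in an abelian category the kernel of the retraction supplies the
    complement. *)
Definition addc U X : Prop := fadd U (idmor X).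

Lemma fadd0 U X Y : fadd U (0 : Mor X Y).
Proof. by exists [::]; rewrite big_nil. Qed.

Lemma faddD U X Y (h h' : Mor X Y) : fadd U h -> fadd U h' -> fadd U (h + h').
Proof. by move=> [s ->] [s' ->]; exists (s ++ s'); rewrite big_cat. Qed.

Lemma fadd_comp U X Y X' Y' (h : Mor X Y) (a : Mor X' X) (b : Mor Y Y') :
  fadd U h -> fadd U (b \c h \c a).
Proof.
move=> [s ->]; exists [seq (b \c p.1, p.2 \c a) | p <- s].
rewrite big_map compm_sumr compm_suml; apply: eq_bigr => p _ /=.
by rewrite !compmA.
Qed.

Lemma addc_fadd U Z X Y (a : Mor X Z) (b : Mor Z Y) : addc U Z -> fadd U (b \c a).
Proof. by move/(fadd_comp a b); rewrite compm1. Qed.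

Lemma fadd_trans U U' X Y (h : Mor X Y) : addc U' U -> fadd U h -> fadd U' h.
Proof.
move=> UU [s ->]; elim: s => [|p s IH]; rewrite ?big_nil ?big_cons; first exact: fadd0.
by apply: faddD IH; exact: addc_fadd UU.
Qed.

Lemma addc_trans U U' X : addc U' U -> addc U X -> addc U' X.
Proof. exact: fadd_trans. Qed.

Lemma addc_refl U : addc U U.
Proof. by exists [:: (idmor U, idmor U)]; rewrite big_seq1 comp1m. Qed.

Lemma addc_dsum2 U X Y S : is_dsum2 X Y S -> addc U X -> addc U Y -> addc U S.
Proof.
move=> /is_dsum2P [i1 [i2 [p1 [p2 [_ _ _ _ SE]]]]] UX UY.
by rewrite /addc -SE; apply: faddD; apply: addc_fadd.
Qed.

Lemma addc_dsum2l U V S : is_dsum2 U V S -> addc S U.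
Proof.
move=> /is_dsum2P [i1 [i2 [p1 [p2 [H _ _ _ _]]]]].
by exists [:: (p1, i1)]; rewrite big_seq1.
Qed.

Lemma addc_dsum2r U V S : is_dsum2 U V S -> addc S V.
Proof.
move=> /is_dsum2P [i1 [i2 [p1 [p2 [_ H _ _ _]]]]].
by exists [:: (p2, i2)]; rewrite big_seq1.
Qed.

Lemma projective_dsum2 X Y S :
  is_dsum2 X Y S -> projective X -> projective Y -> projective S.
Proof.
move=> /is_dsum2P [i1 [i2 [p1 [p2 [_ _ _ _ SE]]]]] pX pY V W g f eg.
have [a aE] := pX _ _ g (f \c i1) eg; have [b bE] := pY _ _ g (f \c i2) eg.
exists (a \c p1 + b \c p2).
by rewrite compmDr !compmA aE bE -!compmA -compmDr SE compm1.
Qed.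

Lemma projective_retract X Y (s : Mor X Y) (t : Mor Y X) :
  t \c s = idmor X -> projective Y -> projective X.
Proof.
move=> ts pY V W g f eg; have [a aE] := pY _ _ g (f \c t) eg.
by exists (a \c s); rewrite compmA aE -compmA ts compm1.
Qed.

Lemma projective0 X : is_zero X -> projective X.
Proof.
move=> X0 Y Z g f _; exists 0.
by have [X0Z _] := X0 Z; rewrite compm0 (X0Z f).
Qed.

(** Exactness in terms of generalised elements, suited to diagram chases. Uniqueness of the lift [x]
    is already contained in the first clause. *)
Definition ses X Y Z (f : Mor X Y) (g : Mor Y Z) : Prop :=
  [/\ forall T (x : Mor T X), f \c x = 0 -> x = 0,
      g \c f = 0,
      forall T (y : Mor T Y), g \c y = 0 -> exists x, y = f \c x
    & epi g].

Lemma ses_inj X Y Z (f : Mor X Y) (g : Mor Y Z) : ses f g ->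
  forall T (x x' : Mor T X), f \c x = f \c x' -> x = x'.
Proof. by case=> mf _ _ _; apply/mono0P. Qed.

Lemma projective_lift T Y Z (g : Mor Y Z) (z : Mor T Z) :
  projective T -> epi g -> exists y, z = g \c y.
Proof. by move=> pT eg; have [y] := pT _ _ g z eg; exists y. Qed.

(** Lets [horseshoe] be applied with one end covering itself, and pads projective resolutions by
    zeros. *)
Lemma ses_id Z X : is_zero Z -> ses (0 : Mor Z X) (idmor X).
Proof.
move=> Z0; split.
- by move=> T x _; have [_ TZ0] := Z0 T; apply: TZ0.
- by rewrite compm0.
- by move=> T y; rewrite comp1m => ->; exists 0; rewrite compm0.
- by move=> T g h; rewrite !compm1.
Qed.

(* [resol F E m X]: X has an exact sequence 0 -> V_m -> ... -> V_0 -> X -> 0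
   with V_k in F for k < m and V_m in E, cut into short exact sequences. *)
Fixpoint resol (F E : D -> Prop) (m : nat) (X : D) : Prop :=
  match m with
  | 0%N => exists V, isomorphic V X /\ E V
  | m.+1 => exists K W (f : Mor K W) (g : Mor W X),
      [/\ ses f g, F W & resol F E m K]
  end.

Definition iso_closed (E : D -> Prop) := forall X Y, isomorphic X Y -> E X -> E Y.

Lemma resol_impl (F E E' : D -> Prop) m X :
  (forall X, E X -> E' X) -> resol F E m X -> resol F E' m X.
Proof.
move=> EE; elim: m X => [|m IH] X /=.
  by case=> V [VX /EE ?]; exists V.
by case=> K [W [f [g [? ? /IH ?]]]]; exists K, W, f, g.
Qed.

Lemma resol_implF (F F' E : D -> Prop) m X :
  (forall X, F X -> F' X) -> resol F E m X -> resol F' E m X.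
Proof.
move=> FF; elim: m X => [|m IH] X //=.
by case=> K [W [f [g [? /FF ? /IH ?]]]]; exists K, W, f, g.
Qed.

End Preadditive.

(** * Exactness, resolutions and diagram chases in an abelian category with enough projectives *)

Section Abelian.
Variable D : preaddCat.
Hypothesis abD : abelianCat D.
Hypothesis epD : enough_projectives D.
Implicit Types X Y Z T U : D.

Lemma ex_kernel X Y (f : Mor X Y) : exists K (k : Mor K X),
  [/\ forall T (x : Mor T K), k \c x = 0 -> x = 0, f \c k = 0
    & forall T (y : Mor T X), f \c y = 0 -> exists x, y = k \c x].
Proof.
have [K [k [fk0 kP]]] := abelian_ker abD f.
exists K, k; split=> // T x.
  move=> kx0; have [u [_ uP]] := kP T 0 (compm0 _ f).
  by rewrite -(uP x kx0); apply: uP; rewrite compm0.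
by case/kP => u [<- _]; exists u.
Qed.

Lemma epi_ses X Y (g : Mor X Y) : epi g -> exists K (k : Mor K X), ses k g.
Proof.
by move=> eg; have [K [k [mk gk kP]]] := ex_kernel g; exists K, k.
Qed.

(** An epi [p] from a projective onto [Z] that factors through [g] forces [g] to be epi. Chases can
    thus be run on elements with projective domain, which lift along any epi. *)
Lemma epi_by_projective Y Z (g : Mor Y Z) :
  (forall T, projective T -> forall z : Mor T Z, exists y, z = g \c y) -> epi g.
Proof.
move=> gP; have [T [p [pT ep]]] := epD Z; have [y pE] := gP T pT p.
by move=> W h h' hg; apply: ep; rewrite pE !compmA hg.
Qed.

Lemma mono_by_projective Y Z (g : Mor Y Z) :
  (forall T, projective T -> forall y : Mor T Y, g \c y = 0 -> y = 0) -> mono g.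
Proof.
move=> gP; apply/mono0P => T x gx0; have [Q [p [pQ ep]]] := epD T.
by apply: ep; rewrite comp0m; apply: gP; rewrite // compmA gx0 comp0m.
Qed.

(** The epi [f] is a cokernel of some [g]; as [f] is mono, [g] = 0, so the identity of [X] factors
    through [f]. *)
Lemma mono_epi_iso X Y (f : Mor X Y) : mono f -> epi f ->
  exists f' : Mor Y X, f' \c f = idmor X /\ f \c f' = idmor Y.
Proof.
move=> mf ef; have [Z [g [fg fP]]] := abelian_epi abD ef.
have g0 : g = 0 by apply: mf; rewrite fg compm0.
have [|u [uf _]] := fP X (idmor X); first by rewrite g0 compm0.
by exists u; split=> //; apply: ef; rewrite -compmA uf compm1 comp1m.
Qed.

Lemma ex_image X Y (f : Mor X Y) :
  exists J Q (u : Mor X J) (m : Mor J Y) (c : Mor Y Q),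
    [/\ epi u, f = m \c u, ses m c & is_cokernel f c].
Proof.
have [Q [c cf]] := abelian_coker abD f.
have [cf0 cP] := cf.
have ec : epi c.
  apply/epi0P => T h hc; have [|v [_ vP]] := cP T 0; first by rewrite comp0m.
  by rewrite -(vP h hc); apply: vP; rewrite comp0m.
have [J [m [mm cm mP]]] := ex_kernel c.
have [u fE] := mP _ f cf0.
exists J, Q, u, m, c; split=> //.
(* If [h] kills [u], then [u] lands in the kernel [k] of [h]. The mono [m \c k] is a kernel of some
   [g]; this [g] kills [f], hence factors through [c] and kills [m]. So [m] factors through
   [m \c k], [k] has a section, and [h] = 0. *)
apply/epi0P => T h hu; have [L [k [mk hk kP]]] := ex_kernel h.
have [u' uE] := kP _ u hu.
have mmk : mono (m \c k) by apply/mono0P => W x; rewrite -compmA => /mm/mk.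
have [Z [g [gmk gP]]] := abelian_mono abD mmk.
have [|w [wE _]] := cP Z g.
  by rewrite fE uE [in m \c _]compmA compmA gmk comp0m.
have [|s [sE _]] := gP _ m; first by rewrite -wE -compmA cm compm0.
have ks : k \c s = idmor J.
  apply/eqP; rewrite -subr_eq0; apply/eqP/mm.
  by rewrite compmBr compmA sE compm1 subrr.
by rewrite -(compm1 h) -ks compmA hk comp0m.
Qed.

(** Elements of the image are guaranteed to lift along the epi [u] onto it only from a projective
    domain, hence the restricted test objects. *)
Lemma exact_atP X Y Z (f : Mor X Y) (g : Mor Y Z) :
  exact_at f g <-> g \c f = 0 /\
    forall T, projective T -> forall y : Mor T Y, g \c y = 0 -> exists x, y = f \c x.
Proof.
have [J [Q [u [m [c [eu fE [mm cm mP ec] cf]]]]]] := ex_image f.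
split.
  move=> [J' [m' [[Q' [c' [[c'f c'P] [c'm' m'P]]]] [gm' gP]]]].
  have [v [vE _]] := cf.2 _ c' c'f.
  have [v' [v'E _]] := c'P _ c cf.1.
  split; first by have [w [<- _]] := m'P _ f c'f; rewrite compmA gm' comp0m.
  move=> T pT y /gP [a [aE _]].
  have [|b yE] := mP T y; first by rewrite -aE -v'E -compmA (compmA c') c'm' comp0m compm0.
  by have [x xE] := projective_lift b pT eu; exists x; rewrite yE xE fE compmA.
move=> [gf fP].
have [K [k [mk gk kP]]] := ex_kernel g.
have gu T : forall h : Mor T Y, g \c h = 0 -> exists! u : Mor T K, k \c u = h.
  move=> h /kP [x hE]; exists x; split=> // x' x'E.
  by apply/eqP; rewrite -subr_eq0; apply/eqP/mk; rewrite compmBr x'E hE subrr.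
exists K, k; split; last by split.
exists Q, c; split=> //; split.
  have [T [p [pT ep]]] := epD K.
  apply: ep; have [|x xE] := fP T pT (k \c p); first by rewrite compmA gk comp0m.
  by rewrite -compmA xE comp0m compmA cf.1 comp0m.
move=> T h ch; apply: gu.
by have [w [<- _]] := cf.2 _ g gf; rewrite -compmA ch compm0.
Qed.

Lemma short_exactP X Y Z (f : Mor X Y) (g : Mor Y Z) : short_exact f g <-> ses f g.
Proof.
split.
  move=> [mf /exact_atP [gf fP] eg]; have [J [Q [u [m [c [eu fE [mm cm mP ec] cf]]]]]] := ex_image f.
  (* As [f] is mono, the epi part [u] of its factorisation is invertible, which gives lifts from
     every [T] and not only from projectives. *)
  have mu : mono u.
    by apply/mono0P => T x ux; apply/(mono0P f).1 => //; rewrite fE -compmA ux compm0.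
  have [u' [u'u uu']] := mono_epi_iso mu eu.
  split=> //; first exact/mono0P.
  move=> T y gy; have [|x xE] := mP T y.
    have [T' [p [pT' ep]]] := epD T; apply: ep.
    have [|x xE] := fP T' pT' (y \c p); first by rewrite compmA gy comp0m.
    by rewrite -compmA xE comp0m compmA cf.1 comp0m.
  by exists (u' \c x); rewrite fE -compmA (compmA u) uu' comp1m.
move=> [mf gf fP eg]; split=> //; first exact/mono0P.
by apply/exact_atP; split=> // T pT y /fP.
Qed.

Lemma ses_iso X Y Z (f : Mor X Y) (g : Mor Y Z) : is_zero X -> ses f g ->
  isomorphic Y Z.
Proof.
move=> f0 [_ _ fP eg]; have [|g' [gg' g'g]] := mono_epi_iso _ eg.
  by apply/mono0P => T y /fP [x ->]; have [_ X0] := f0 T; rewrite (X0 x) compm0.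
by exists g, g'.
Qed.

Lemma ses_iso_r X Y Z Z' (f : Mor X Y) (g : Mor Y Z) : ses f g -> isomorphic Z Z' ->
  exists g' : Mor Y Z', ses f g'.
Proof.
move=> [mf gf fP eg] [h [h' [h'h hh']]]; exists (h \c g); split=> //.
- by rewrite -compmA gf compm0.
- by move=> T y hgy; apply: fP; rewrite -(comp1m (g \c y)) -h'h -compmA [h \c _]compmA hgy compm0.
- by move=> T a b; rewrite !compmA => /eg ab; rewrite -(compm1 a) -(compm1 b) -hh' !compmA ab.
Qed.

Lemma ses_iso_l X X' Y Z (f : Mor X Y) (g : Mor Y Z) : ses f g -> isomorphic X' X ->
  exists f' : Mor X' Y, ses f' g.
Proof.
move=> [mf gf fP eg] [h [h' [h'h hh']]]; exists (f \c h); split=> //.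
- move=> T x; rewrite -compmA => /mf hx.
  by rewrite -(comp1m x) -h'h -compmA hx compm0.
- by rewrite compmA gf comp0m.
- by move=> T y /fP [x ->]; exists (h' \c x); rewrite -compmA (compmA h) hh' comp1m.
Qed.

(** Cuts the long sequence at the kernel of its augmentation, and splices it back. For [m] = 0 the
    zero padding makes the augmentation an isomorphism. *)
Lemma exact_resP (F E : D -> Prop) m X :
  (exists (V : nat -> D) (d : forall k, Mor (V k.+1) (V k)) (a : Mor (V 0%N) X),
    [/\ exact_res m d a, forall k, (k < m)%N -> F (V k) & E (V m)]) <->
  resol F E m X.
Proof.
split; elim: m X => [|m IH] X /=.
- move=> [V [d [a [[V0 ea /exact_atP [_ aP] _] _ EV]]]].
  exists (V 0%N); split=> //.
  have [|a' [a'a aa']] := mono_epi_iso _ ea; last by exists a, a'.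
  apply: mono_by_projective => T pT y /(aP _ pT) [x ->].
  by have [V1 _] := V0 1%N isT T; have [_ V1'] := V0 1%N isT T; rewrite (V1' x) compm0.
- move=> [V [d [a [[V0 ea /exact_atP [ad aP] dP] FV EV]]]].
  have [K [k sk]] := epi_ses ea; have [mk ak kP _] := sk.
  have [b bE] := kP _ _ ad.
  exists K, (V 0%N), k, a; split=> //; first exact: FV.
  apply: IH; exists (V \o S), (fun j => d j.+1), b; split=> //; last by move=> j jm; apply: FV.
  split=> //; first by move=> j jm; apply: V0.
  + apply: epi_by_projective => T pT z; have [|x xE] := aP T pT (k \c z).
      by rewrite compmA ak comp0m.
    by exists x; apply: (ses_inj sk); rewrite xE bE compmA.
  + have /exact_atP [dd ddP] := dP 0%N.
    apply/exact_atP; split; first by apply: mk; rewrite compmA -bE.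
    by move=> T pT y byE; apply: ddP; rewrite // bE -compmA byE compm0.
  + by move=> j; apply: dP.
- move=> [V [[f [g [gf fg]]] EV]]; have [Z Z0] := abelian_zero abD.
  exists (fun k => if k is 0%N then V else Z), (fun k => 0), f; split=> //; split.
  + by case.
  + by apply/epi0P => T x xf; rewrite -(compm1 x) -fg compmA xf comp0m.
  + apply/exact_atP; split; first by rewrite compm0.
    by move=> T pT y fy; exists 0; rewrite compm0 -(comp1m y) -gf -compmA fy compm0.
  + move=> k; apply/exact_atP; split; first by rewrite compm0.
    by move=> T pT y _; exists 0; rewrite compm0; have [_ TZ0] := Z0 T; apply: TZ0.
- move=> [K [W [f [g [[mf gf fP eg] FW /IH [V [d [a [[V0 ea da dP] FV EV]]]]]]]]].
  pose V' k := if k is k'.+1 then V k' else W.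
  exists V', (fun k => match k return Mor (V' k.+1) (V' k) with
    0%N => f \c a | k'.+1 => d k' end), g.
  split; [split=> //| by case|done].
  + by case.
  + apply/exact_atP; split; first by rewrite compmA gf comp0m.
    move=> T pT y /fP [x ->]; have [z ->] := projective_lift x pT ea.
    by exists z; rewrite compmA.
  + case=> [|k]; last exact: dP.
    move/exact_atP: da => [ad aP].
    apply/exact_atP; split; first by rewrite -compmA ad compm0.
    by move=> T pT y; rewrite -compmA => /mf; apply: aP.
Qed.

Lemma resol_iso (F E : D -> Prop) m : iso_closed (resol F E m).
Proof.
case: m => [|m] X Y XY /=.
  move=> [V [VX EV]]; exists V; split=> //.
  case: VX => a [b [ba ab]]; case: XY => a' [b' [b'a' a'b']].
  exists (a' \c a), (b \c b'); split.
    by rewrite -compmA (compmA b') b'a' comp1m.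
  by rewrite -compmA (compmA a) ab comp1m.
move=> [K [W [f [g [sfg FW EK]]]]]; have [g' sfg'] := ses_iso_r sfg XY.
by exists K, W, f, g'.
Qed.

Lemma ex_syzygy N X : exists K, resol (@projective D) (eq K) N X.
Proof.
elim: N X => [|N IH] X /=; first by exists X, X; split=> //; exact: isomorphic_refl.
have [P [g [pP eg]]] := epD X; have [K [k sk]] := epi_ses eg.
by have [L LK] := IH K; exists L, K, P, k, g.
Qed.

(* The kernel of W (+) P -> Y, where P -> Z is projective and lifted through Y. *)
Lemma horseshoe X Y Z K W M P (i : Mor X Y) (p : Mor Y Z) (k : Mor K W) (g : Mor W X)
    (m : Mor M P) (h : Mor P Z) :
  ses i p -> ses k g -> ses m h -> projective P ->
  exists S L (n : Mor L S) (G : Mor S Y) (a : Mor K L) (b : Mor L M),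
    [/\ is_dsum2 W P S, ses n G & ses a b].
Proof.
move=> si sk sm pP; have [mi pi iP ep] := si; have [mk gk kP eg] := sk.
have [mm hm mP eh] := sm; have [t hE] := projective_lift h pP ep.
have [S dS] := abelian_dsum abD W P.
have [i1 [i2 [p1 [p2 [E1 E2 E3 E4 E5]]]]] := (is_dsum2P _ _ _).1 dS.
pose G := i \c g \c p1 + t \c p2.
have GE T (w : Mor T W) (z : Mor T P) : G \c (i1 \c w + i2 \c z) = i \c (g \c w) + t \c z.
  by rewrite /G compmDr !compmDl !compmA -!(compmA _ p1) -!(compmA _ p2) E1 E2 E3 E4
     !compm0 !comp0m addr0 add0r !compm1.
have SE T (y : Mor T S) : y = i1 \c (p1 \c y) + i2 \c (p2 \c y).
  by rewrite !compmA -compmDl E5 comp1m.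
have eG : epi G.
  apply: epi_by_projective => T pT y.
  have [b bE] := projective_lift (p \c y) pT eh.
  have [|x xE] := iP T (y - t \c b); first by rewrite compmBr bE hE compmA subrr.
  have [w wE] := projective_lift x pT eg.
  by exists (i1 \c w + i2 \c b); rewrite GE -wE -xE subrK.
have [L [n sn]] := epi_ses eG; have [mn Gn nP _] := sn.
have [|a aE] := nP _ (i1 \c k).
  by have := GE K k 0; rewrite !compm0 !addr0 gk compm0.
have [|b bE] := mP _ (p2 \c n).
  have := congr1 (fun x => p \c x) Gn.
  by rewrite [in X in X -> _](SE _ n) GE compm0 compmDr !compmA pi !comp0m add0r -hE.
exists S, L, n, G, a, b; split=> //; split.
- move=> T x ax; apply: mk; have: i1 \c (k \c x) = 0 by rewrite compmA aE -compmA ax compm0.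
  by move/(congr1 (fun x => p1 \c x)); rewrite compmA E1 comp1m compm0.
- by apply: mm; rewrite compmA -bE -compmA -aE compmA E4 comp0m.
- move=> T y by0; have p2n : p2 \c (n \c y) = 0 by rewrite compmA bE -compmA by0 compm0.
  have nE : n \c y = i1 \c (p1 \c (n \c y)) by rewrite {1}(SE _ (n \c y)) p2n compm0 addr0.
  have /mi/kP [x xE] : i \c (g \c (p1 \c (n \c y))) = 0.
    have := GE _ (p1 \c (n \c y)) 0; rewrite !compm0 !addr0 => <-.
    by rewrite -nE compmA Gn comp0m.
  by exists x; apply: (ses_inj sn); rewrite nE xE compmA aE -compmA.
- apply: epi_by_projective => T pT c; pose z := m \c c.
  have /iP [x xE] : p \c (t \c z) = 0 by rewrite compmA -hE /z compmA hm comp0m.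
  have [w wE] := projective_lift x pT eg.
  have [|y yE] := nP _ (i1 \c (- w) + i2 \c z).
    by rewrite GE !compmN -wE xE addNr.
  exists y; apply: (ses_inj sm); rewrite -/z compmA -bE -compmA -yE.
  by rewrite compmDr !compmA E4 E2 comp0m add0r comp1m.
Qed.

(** The kernel of [P -> L -> J] is the preimage of [Z] under [g], hence an extension of [Z] by [K].
    For projective [P] this rotates [Z -> L -> J] to a sequence from a syzygy of [L] through one of
    [J] to [Z]. *)
Lemma ses_rotate Z L J P K (z : Mor Z L) (u : Mor L J) (k : Mor K P) (g : Mor P L) :
  ses z u -> ses k g ->
  exists K' (k' : Mor K' P) (a : Mor K K') (b : Mor K' Z), ses k' (u \c g) /\ ses a b.
Proof.
move=> sz sk; have [mz uz zP eu] := sz; have [mk gk kP eg] := sk.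
have eug : epi (u \c g) by move=> T x y; rewrite !compmA => /eg/eu.
have [K' [k' sk']] := epi_ses eug; have [mk' ugk' k'P _] := sk'.
have [|a aE] := k'P _ k; first by rewrite -compmA gk compm0.
have [|b bE] := zP _ (g \c k'); first by rewrite compmA.
exists K', k', a, b; split=> //; split.
- by move=> T x ax; apply: mk; rewrite aE -compmA ax compm0.
- by apply: mz; rewrite compmA -bE -compmA -aE gk.
- move=> T y by0; have [|x xE] := kP _ (k' \c y); first by rewrite compmA bE -compmA by0 compm0.
  by exists x; apply: (ses_inj sk'); rewrite xE aE compmA.
- apply: epi_by_projective => T pT c; have [w wE] := projective_lift (z \c c) pT eg.
  have [|y yE] := k'P _ w; first by rewrite -compmA -wE compmA uz comp0m.
  by exists y; apply: (ses_inj sz); rewrite compmA -bE -compmA -yE.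
Qed.

(** Iterating [horseshoe] replaces an extension by one between [N]-th syzygies. *)
Lemma resol_ext (E E' : D -> Prop) N X Y Z (i : Mor X Y) (p : Mor Y Z) :
  ses i p -> resol (@projective D) E N X -> resol (@projective D) E' N Z ->
  resol (@projective D) (fun Y' => exists X' Z' (i' : Mor X' Y') (p' : Mor Y' Z'),
     [/\ ses i' p', E X' & E' Z']) N Y.
Proof.
elim: N X Y Z i p => [|N IH] X Y Z i p s /=.
  move=> [X' [X'X EX']] [Z' [Z'Z EZ']]; exists Y; split; first exact: isomorphic_refl.
  have [i' s'] := ses_iso_l s X'X.
  have [p' s''] := ses_iso_r s' (isomorphic_sym Z'Z).
  by exists X', Z', i', p'.
move=> [K [W [k [g [sk pW EK]]]]] [M [P [m [h [sm pP EM]]]]].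
have [S [L [n [G [a [b [dS sn sab]]]]]]] := horseshoe s sk sm pP.
exists L, S, n, G; split=> //; first exact: projective_dsum2 dS pW pP.
exact: IH sab EK EM.
Qed.

End Abelian.

(** * Stable isomorphism *)

Section Stable.
Variable D : preaddCat.
Hypothesis abD : abelianCat D.
Hypothesis epD : enough_projectives D.
Implicit Types X Y Z T U : D.

(* Isomorphism in the stable category, i.e. modulo morphisms factoring through
   projectives. *)
Definition stably_iso X X' : Prop :=
  exists (s : Mor X X') (t : Mor X' X) Q (u : Mor X Q) (v : Mor Q X)
    Q' (u' : Mor X' Q') (v' : Mor Q' X'),
    [/\ projective Q, projective Q', idmor X = t \c s + v \c u
      & idmor X' = s \c t + v' \c u'].

Lemma isomorphic_stable X X' : isomorphic X X' -> stably_iso X X'.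
Proof.
move=> [s [t [ts st]]]; have [Z /projective0 pZ] := abelian_zero abD.
by exists s, t, Z, 0, 0, Z, 0, 0; split; rewrite // compm0 addr0.
Qed.

Lemma syzygy_map X X' K P K' P' (k : Mor K P) (g : Mor P X) (k' : Mor K' P')
    (g' : Mor P' X') (s : Mor X X') :
  ses k g -> ses k' g' -> projective P ->
  exists sP sK, g' \c sP = s \c g /\ k' \c sK = sP \c k.
Proof.
move=> [_ gk _ _] [_ _ kP' eg'] pP.
have [sP sPE] := projective_lift (s \c g) pP eg'.
have [|sK sKE] := kP' _ (sP \c k); first by rewrite compmA -sPE -compmA gk compm0.
by exists sP, sK.
Qed.

(** Lift [v] to [v'] along [g]. The identity of [P] minus [aP] minus [v' u g] then lands in the
    kernel of [g], which gives [w]; restriction along [k] removes the [v'] term because [g k] =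
    0. *)
Lemma syzygy_defect X K P Q (k : Mor K P) (g : Mor P X) (a : Mor X X) (aP : Mor P P)
    (aK : Mor K K) (u : Mor X Q) (v : Mor Q X) :
  ses k g -> projective Q -> g \c aP = a \c g -> k \c aK = aP \c k ->
  idmor X = a + v \c u -> exists w, idmor K = aK + w \c k.
Proof.
move=> sk pQ ga ka idX; have [mk gk kP eg] := sk.
have [v' v'E] := projective_lift v pQ eg.
have [|w wE] := kP _ (idmor P - aP - v' \c (u \c g)).
  rewrite !compmBr compm1 ga compmA -v'E compmA -[X in X - _ - _]comp1m -!compmBl idX.
  by rewrite addrAC addrK subrr comp0m.
exists w; apply: (ses_inj sk); rewrite compmDr compmA -wE !compmBl comp1m ka -!compmA gk.
by rewrite !compm0 subr0 compm1 addrC subrK.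
Qed.

(** Syzygies are functorial modulo maps through projectives. For [X] = [X'] this is Schanuel's lemma
    in stable form. *)
Lemma stably_iso_syzygy X X' K P K' P' (k : Mor K P) (g : Mor P X) (k' : Mor K' P')
    (g' : Mor P' X') :
  stably_iso X X' -> ses k g -> ses k' g' -> projective P -> projective P' ->
  stably_iso K K'.
Proof.
move=> [s [t [Q [u [v [Q' [u' [v' [pQ pQ' idX idX']]]]]]]]] sk sk' pP pP'.
have [sP [sK [sP1 sK1]]] := syzygy_map s sk sk' pP.
have [tP [tK [tP1 tK1]]] := syzygy_map t sk' sk pP'.
have [||w wE] := syzygy_defect (aP := tP \c sP) (aK := tK \c sK) sk pQ _ _ idX.
- by rewrite compmA tP1 -compmA sP1 compmA.
- by rewrite compmA tK1 -compmA sK1 compmA.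
have [||w' w'E] := syzygy_defect (aP := sP \c tP) (aK := sK \c tK) sk' pQ' _ _ idX'.
- by rewrite compmA sP1 -compmA tP1 compmA.
- by rewrite compmA sK1 -compmA tK1 compmA.
by exists sK, tK, P, k, w, P', k', w'.
Qed.

Definition add_res U m : D -> Prop := resol (addc U) (addc U) m.

Definition contains_proj U : Prop := forall Q, projective Q -> addc U Q.

Lemma add_res_mono U U' m X : addc U' U -> add_res U m X -> add_res U' m X.
Proof.
move=> UU' /(resol_impl (fun X => @addc_trans D U U' X UU')).
exact: resol_implF (fun X => @addc_trans D U U' X UU').
Qed.

Lemma addc_iso U : iso_closed (addc U).
Proof.
by move=> X Y [f [g [gf fg]]] /(addc_fadd g f); rewrite fg.
Qed.

Lemma add_res0 U X : add_res U 0 X <-> addc U X.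
Proof.
split; first by move=> [V [VX UV]]; exact: addc_iso VX UV.
by move=> UX; exists X; split=> //; exact: isomorphic_refl.
Qed.

(** Induction on [m]: from [0 -> K1 -> W -> K' -> 0] one builds an epi from the sum of [W] and [Q]
    onto [K], whose kernel [K2] is stably isomorphic to [K1]. The new term stays in add(U) because
    [U] generates the projectives. *)
Lemma add_res_stable U m K K' : contains_proj U -> stably_iso K K' ->
  add_res U m K' -> add_res U m K.
Proof.
move=> bU; elim: m K K' => [|m IH] K K'.
  move=> [s [t [Q [u [v [Q' [u' [v' [pQ pQ' idX idX']]]]]]]]].
  rewrite !add_res0 => UK'; rewrite /addc idX; apply: faddD.
    exact: addc_fadd UK'.
  exact: addc_fadd (bU _ pQ).
move=> [s [t [Q [u [v [Q' [u' [v' [pQ pQ' idX idX']]]]]]]]].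
move=> [K1 [W [k [g [sk UW HK1]]]]]; have [mk gk kP eg] := sk.
have [S dS] := abelian_dsum abD W Q.
have [i1 [i2 [p1 [p2 [E1 E2 E3 E4 E5]]]]] := (is_dsum2P _ _ _).1 dS.
have SE T (y : Mor T S) : y = i1 \c (p1 \c y) + i2 \c (p2 \c y).
  by rewrite !compmA -compmDl E5 comp1m.
pose h := t \c g \c p1 + v \c p2.
have hE T (w : Mor T W) (z : Mor T Q) :
    h \c (i1 \c w + i2 \c z) = t \c (g \c w) + v \c z.
  by rewrite /h compmDr !compmDl !compmA -!(compmA _ p1) -!(compmA _ p2) E1 E2 E3 E4
     !compm0 !comp0m addr0 add0r !compm1.
have eh : epi h.
  apply: epi_by_projective => // T pT x.
  have [w wE] := projective_lift (s \c x) pT eg.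
  exists (i1 \c w + i2 \c (u \c x)); rewrite hE -wE !compmA -compmDl -idX comp1m //.
have [K2 [n sn]] := epi_ses abD eh; have [mn hn nP _] := sn.
have hn' : t \c (g \c (p1 \c n)) + v \c (p2 \c n) = 0.
  by rewrite -hE -(SE _ n) hn.
(* Y is the kernel of K' (+) Q -> K, a retract of Q' (+) Q, and K2 = K1 (+) Y. *)
have [S' dS'] := abelian_dsum abD K' Q.
have [j1 [j2 [q1 [q2 [F1 F2 F3 F4 F5]]]]] := (is_dsum2P _ _ _).1 dS'.
have S'E T (y : Mor T S') : y = j1 \c (q1 \c y) + j2 \c (q2 \c y).
  by rewrite !compmA -compmDl F5 comp1m.
pose f := t \c q1 + v \c q2.
have fE T (a : Mor T K') (z : Mor T Q) : f \c (j1 \c a + j2 \c z) = t \c a + v \c z.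
  by rewrite /f compmDr !compmDl !compmA -!(compmA _ q1) -!(compmA _ q2) F1 F2 F3 F4
     !compm0 !comp0m addr0 add0r !compm1.
have [Y [y [my fy yP]]] := ex_kernel abD f.
have fy' : t \c (q1 \c y) + v \c (q2 \c y) = 0 by rewrite -fE -(S'E _ y) fy.
have pY : projective Y.
  have [S2 dS2] := abelian_dsum abD Q' Q.
  have [l1 [l2 [r1 [r2 [G1 G2 G3 G4 G5]]]]] := (is_dsum2P _ _ _).1 dS2.
  (* [sf] is a section of [f], so [c - sf f c] lands in [Y]. On [Y] one has [t q1 = - v q2], and the
     formula for the identity of [K'] shows that [Y -> S2 -> Y] is the identity. *)
  pose c := j1 \c (v' \c r1 - s \c (v \c r2)) + j2 \c r2.
  pose sf := j1 \c s + j2 \c u.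
  have fsf : f \c sf = idmor K by rewrite fE idX.
  have [|b bE] := yP _ (c - sf \c (f \c c)).
    by rewrite compmBr [f \c (sf \c _)]compmA fsf comp1m subrr.
  apply: (@projective_retract _ Y S2 (l1 \c (u' \c (q1 \c y)) + l2 \c (q2 \c y)) b).
    set z := l1 \c _ + _.
    have r1z : r1 \c z = u' \c (q1 \c y).
      by rewrite /z compmDr !compmA G1 G3 !comp0m addr0 comp1m.
    have r2z : r2 \c z = q2 \c y.
      by rewrite /z compmDr !compmA G4 G2 !comp0m add0r comp1m.
    have cz : c \c z = y.
      rewrite /c compmDl -!compmA compmBl -!compmA r1z r2z [RHS](S'E _ y).
      have -> : v \c (q2 \c y) = - (t \c (q1 \c y)).
        by apply/eqP; rewrite -addr_eq0 addrC fy'.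
      congr (_ \c _ + _); rewrite compmN opprK !compmA -!compmDl addrC.
      by rewrite -idX' comp1m.
    apply/eqP; rewrite -subr_eq0; apply/eqP/my.
    by rewrite compmBr compm1 compmA -bE compmBl -!compmA cz fy !compm0 subr0 subrr.
  exact: projective_dsum2 dS2 pQ' pQ.
have [|b bE] := yP _ (j1 \c (g \c (p1 \c n)) + j2 \c (p2 \c n)); first by rewrite fE.
have q1y : q1 \c (y \c b) = g \c (p1 \c n).
  by rewrite -bE compmDr !compmA F1 F3 comp1m !comp0m addr0.
have q2y : q2 \c (y \c b) = p2 \c n.
  by rewrite -bE compmDr !compmA F4 F2 comp1m !comp0m add0r.
have eb : epi b.
  apply: epi_by_projective => // T pT x.
  have [w wE] := projective_lift (q1 \c (y \c x)) pT eg.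
  have [|z zE] := nP _ (i1 \c w + i2 \c (q2 \c (y \c x))).
    have := congr1 (fun w => w \c x) fy'; rewrite compmDl comp0m -!compmA => <-.
    by rewrite hE wE.
  exists z; apply/eqP; rewrite -subr_eq0; apply/eqP/my; rewrite compmBr.
  rewrite (S'E _ (y \c x)) [y \c (b \c z)]compmA -bE compmDl -!compmA -zE.
  rewrite !compmDr !(compmA p1) !(compmA p2) E1 E2 E3 E4 !comp1m !comp0m !compm0 addr0 add0r.
  by rewrite -wE subrr.
have [|a aE] := nP _ (i1 \c k).
  by have := hE _ k 0; rewrite !compm0 !addr0 gk compm0.
have sab : ses a b.
  split=> //.
  - move=> T x ax; apply: mk; have: i1 \c (k \c x) = 0 by rewrite compmA aE -compmA ax compm0.
    by move/(congr1 (fun x => p1 \c x)); rewrite compmA E1 comp1m compm0.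
  - apply: my; rewrite compmA -bE compmDl -!compmA -aE !(compmA p1) !(compmA p2) E1 E4.
    by rewrite comp1m gk comp0m !compm0 addr0.
  - move=> T z bz; have z1 : g \c (p1 \c (n \c z)) = 0.
      by rewrite (compmA p1) (compmA g) -q1y -!compmA bz !compm0.
    have z2 : p2 \c (n \c z) = 0 by rewrite compmA -q2y -!compmA bz !compm0.
    have [x xE] := kP _ _ z1; exists x; apply: (ses_inj sn).
    by rewrite (SE _ (n \c z)) z2 compm0 addr0 xE compmA aE compmA.
(* As [Y] is projective, [b] splits; the identity of [K2] is then [a d] plus a map through [Y], so
   [K2] and [K1] are stably isomorphic. *)
have [c cE] := projective_lift (idmor Y) pY eb.
have [ma ba aP _] := sab.
have [|d dE] := aP _ (idmor K2 - c \c b).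
  by rewrite compmBr compmA -cE comp1m compm1 subrr.
exists K2, S, n, h; split=> //; first exact: addc_dsum2 dS UW (bU _ pQ).
apply: IH HK1; have [Z0 /projective0 pZ0] := abelian_zero abD.
exists d, a, Y, b, c, Z0, 0, 0; split=> //; first by rewrite -dE subrK.
rewrite compm0 addr0; apply: (ses_inj sab).
by rewrite compmA -dE compmBl comp1m -compmA ba compm0 subr0 compm1.
Qed.

(** A single projective resolution with a good [N]-th syzygy suffices for all others: compare them
    one syzygy at a time. *)
Lemma add_res_syzygies U m N X X' : contains_proj U -> stably_iso X X' ->
  resol (@projective D) (add_res U m) N X' ->
  forall K, resol (@projective D) (eq K) N X -> add_res U m K.
Proof.
move=> bU; elim: N X X' => [|N IH] X X' XX' /=.
  move=> [V [VX' UV]] K [V' [V'X VK]]; subst V'.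
  have {}UV := resol_iso VX' UV.
  by apply: (resol_iso (isomorphic_sym V'X)); apply: add_res_stable UV.
move=> [K' [P' [k' [g' [sk' pP' HK']]]]] K [L [P [k [g [sk pP LK]]]]].
by apply: IH HK' _ LK; apply: stably_iso_syzygy XX' sk sk' pP pP'.
Qed.

(** Lift each summand [Z -> U -> Z] of the identity to the chosen projectives. The induced
    endomorphism of [M] factors through copies of [KU] and differs from the identity by a map
    through [P]. *)
Lemma addc_syzygy U U' KU PU Z M P (k : Mor M P) (g : Mor P Z) (kU : Mor KU PU)
    (gU : Mor PU U) :
  contains_proj U' -> addc U' KU -> ses kU gU -> projective PU ->
  ses k g -> projective P -> addc U Z -> addc U' M.
Proof.
move=> bU' UKU skU pPU sk pP [s sE].
have [aP [aK [ga ka UaK]]] : exists aP aK,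
   [/\ g \c aP = (\sum_(p <- s) p.1 \c p.2) \c g, k \c aK = aP \c k & fadd KU aK].
  elim: s {sE} => [|[f h] s [aP [aK [ga ka UaK]]]].
    by exists 0, 0; rewrite big_nil !compm0 !comp0m; split=> //; exact: fadd0.
  have [fP [fK [fP1 fK1]]] := syzygy_map f skU sk pPU.
  have [hP [hK [hP1 hK1]]] := syzygy_map h sk skU pP.
  exists (fP \c hP + aP), (fK \c hK + aK); split.
  - by rewrite big_cons compmDr compmDl ga compmA fP1 -!compmA hP1.
  - by rewrite compmDr compmDl ka compmA fK1 -!compmA hK1.
  - by apply: faddD UaK; apply: addc_fadd (addc_refl _).
have [Z0 /projective0 pZ0] := abelian_zero abD.
have [|w wE] := syzygy_defect (u := (0 : Mor Z Z0)) (v := 0) sk pZ0 ga ka.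
  by rewrite compm0 addr0.
by rewrite /addc wE; apply: faddD; [exact: fadd_trans UaK|exact: addc_fadd (bU' _ pP)].
Qed.
End Stable.

(** * Extensions *)

Section Extensions.
Variable D : preaddCat.
Hypothesis abD : abelianCat D.
Hypothesis epD : enough_projectives D.
Implicit Types X Y Z T U : D.

(** [U'] is the sum of [U] and one syzygy [KU], chosen before [m] so that it serves every length. *)
Lemma add_res_syzygy U : contains_proj U -> exists U',
  [/\ contains_proj U', addc U' U
    & forall m Z M P (k : Mor M P) (g : Mor P Z), ses k g -> projective P ->
        add_res U m Z -> add_res U' m M].
Proof.
move=> bU; have [PU [gU [pPU egU]]] := epD U; have [KU [kU skU]] := epi_ses abD egU.
have [U' dU'] := abelian_dsum abD U KU.
have UU' := addc_dsum2l dU'; have KUU' := addc_dsum2r dU'.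
have bU' : contains_proj U' by move=> Q /bU; exact: addc_trans.
exists U'; split=> //; elim=> [|m IH] Z M P k g sk pP.
  by rewrite !add_res0; exact: addc_syzygy KUU' skU pPU sk pP.
move=> [Z1 [W [z [u [szu UW HZ1]]]]].
have [PW [gW [pPW egW]]] := epD W; have [KW [kW skW]] := epi_ses abD egW.
have [K' [k' [a [b [sk' sab]]]]] := ses_rotate abD epD szu skW.
have [P1 [g1 [pP1 eg1]]] := epD Z1; have [M1 [k1 sk1]] := epi_ses abD eg1.
have [Z0 Z00] := abelian_zero abD.
(* [K'] is an extension of [Z1] by [KW]. Covering only [Z1] by a projective gives an epi from the
   sum of [KW] and [P1] onto [K'], with kernel the syzygy [M1] of [Z1], ready for induction. *)
have [S [L [n [G [a' [b' [dS sn sab']]]]]]] :=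
  horseshoe abD epD sab (ses_id KW Z00) sk1 pP1.
have XX := isomorphic_stable abD (isomorphic_refl Z).
apply: (add_res_stable abD epD bU' (stably_iso_syzygy XX sk sk' pP pPW)).
exists L, S, n, G; split=> //.
  apply: addc_dsum2 dS _ (bU' _ pP1).
  exact: addc_syzygy KUU' skU pPU skW pPW UW.
have LM1 := isomorphic_sym (ses_iso abD Z00 sab').
exact: resol_iso LM1 (IH _ _ _ _ _ sk1 pP1 HZ1).
Qed.

(* In the stable category [add_res U a] is add U * add U[1] * ... * add U[a]; the
   summands of the resolution of Z are replaced by their (a+1)-st syzygies. *)
Lemma add_res_ext a U : contains_proj U -> exists U',
  [/\ contains_proj U', addc U' U
    & forall b X Y Z (i : Mor X Y) (p : Mor Y Z), ses i p ->
        add_res U a X -> add_res U b Z -> add_res U' (a + b).+1 Y].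
Proof.
elim: a U => [|a IH] U bU; have [U1 [bU1 UU1 HU1]] := add_res_syzygy bU.
  exists U1; split=> // b X Y Z i p sip; rewrite add_res0 => UX HZ.
  have [P [g [pP eg]]] := epD Z; have [M [k sk]] := epi_ses abD eg.
  have [Z0 Z00] := abelian_zero abD.
  (* The sum of [X] and [P] maps onto [Y], with kernel isomorphic to the syzygy [M] of [Z]. *)
  have [S [L [n [G [a' [b' [dS sn sab']]]]]]] :=
    horseshoe abD epD sip (ses_id X Z00) sk pP.
  exists L, S, n, G; split=> //; first exact: addc_dsum2 dS (addc_trans UU1 UX) (bU1 _ pP).
  have LM := isomorphic_sym (ses_iso abD Z00 sab').
  exact: resol_iso LM (HU1 _ _ _ _ _ _ sk pP HZ).
(* The induction runs with [U1], since the syzygy of [Z] produced at each step is resolved over [U1]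
   rather than [U]. *)
have [U2 [bU2 UU2 HU2]] := IH _ bU1.
exists U2; split=> //; first exact: addc_trans UU1.
move=> b X Y Z i p sip [X1 [W [f [h [sfh UW HX1]]]]] HZ.
have [P [g [pP eg]]] := epD Z; have [M [k sk]] := epi_ses abD eg.
have [S [L [n [G [a' [b' [dS sn sab']]]]]]] := horseshoe abD epD sip sfh sk pP.
exists L, S, n, G; split=> //.
  exact: addc_dsum2 dS (addc_trans UU2 (addc_trans UU1 UW)) (bU2 _ pP).
exact: HU2 sab' (add_res_mono UU1 HX1) (HU1 _ _ _ _ _ _ sk pP HZ).
Qed.

Lemma ex_dsum n U : exists S, is_dsum (fun _ : 'I_n => U) S.
Proof.
elim: n => [|n [S [inj [prj [H1 H2 H3]]]]].
  have [Z Z0] := abelian_zero abD; exists Z, (fun => 0), (fun => 0).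
  by split; [case|case|rewrite big_ord0; have [ZZ _] := Z0 Z; apply/esym/ZZ].
have [S' /is_dsum2P [i1 [i2 [p1 [p2 [E1 E2 E3 E4 E5]]]]]] := abelian_dsum abD U S.
exists S', (fun j => if unlift ord0 j is Some j' then i2 \c inj j' else i1).
exists (fun j => if unlift ord0 j is Some j' then prj j' \c p2 else p1).
split.
- move=> j; case: unliftP => [j' _|_] //.
  by rewrite -compmA (compmA p2) E2 comp1m.
- move=> j j'; case: unliftP => [l ->|->]; case: unliftP => [l' ->|->] //.
  + rewrite (inj_eq lift_inj) => ll'.
    by rewrite -compmA (compmA p2) E2 comp1m H2.
  + by move=> _; rewrite -compmA E4 compm0.
  + by move=> _; rewrite compmA E3 comp0m.
- rewrite big_ord_recl unlift_none.
  under eq_bigr do rewrite liftK -compmA (compmA (inj _)) compmA.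
  by rewrite -compm_suml -compm_sumr H3 compm1 E5.
Qed.

Lemma in_addP U X : in_add U X <-> addc U X.
Proof.
split.
  move=> [n [S [Y [[inj [prj [_ _ SE]]] dS]]]].
  apply: addc_trans (addc_dsum2l dS).
  exists [seq (inj j, prj j) | j <- enum 'I_n].
  by rewrite big_map big_enum.
move=> [s sE]; have [S dS] := ex_dsum (size s) U.
have [inj [prj [H1 H2 H3]]] := dS.
pose f (j : 'I_(size s)) := tnth (in_tuple s) j.
pose a := \sum_j inj j \c (f j).2; pose b := \sum_j (f j).1 \c prj j.
have ba : b \c a = idmor X.
  rewrite /b compm_suml sE (big_tnth _ _ s); apply: eq_bigr => j _.
  rewrite /a compm_sumr (bigD1 j) //= big1 ?addr0.
    by rewrite -compmA (compmA (prj j)) H1 comp1m.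
  by move=> l lj; rewrite -compmA (compmA (prj j)) H2 1?eq_sym // comp0m compm0.
exists (size s), S.
(* The kernel of the retraction [b] is the complement of [X] in the power of [U]. *)
have [Y [k [mk bk kP]]] := ex_kernel abD b.
have [|w wE] := kP _ (idmor S - a \c b).
  by rewrite compmBr compm1 compmA ba comp1m subrr.
exists Y; split=> //; apply/is_dsum2P; exists a, k, b, w; split=> //.
- apply/eqP; rewrite -subr_eq0; apply/eqP/mk.
  by rewrite compmBr compmA -wE compmBl comp1m compm1 -compmA bk compm0 subr0 subrr.
- by apply: mk; rewrite compmA -wE compmBl comp1m -compmA ba compm1 subrr.
- by rewrite -wE addrC subrK.
Qed.

Lemma OmegaP n K : Omega n K <-> exists X, resol (@projective D) (eq K) n X.
Proof.
split.
  move=> [X]; case: n => [->|n]; first by exists X, X; split=> //; exact: isomorphic_refl.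
  move=> [V [d [a [rV pV VK]]]]; exists X; apply/exact_resP => //.
  by exists V, d, a.
move=> [X]; case: n => [|n]; first by exists K.
move/(exact_resP abD epD) => [V [d [a [rV pV VK]]]].
by exists X, V, d, a.
Qed.

Lemma IT_categoryP m n : IT_category m n D <->
  exists U, forall X K, resol (@projective D) (eq K) n X -> add_res U m K.
Proof.
split=> -[U HU]; exists U.
  move=> X K XK; have [|V [d [a [rV aV]]]] := HU K; first by apply/OmegaP; exists X.
  apply/exact_resP => //; exists V, d, a; split=> //.
    by move=> k /ltnW/aV/in_addP.
  by apply/in_addP/aV.
move=> K /OmegaP [X /HU /(exact_resP abD epD) [V [d [a [rV aV aVm]]]]].
exists V, d, a; split=> // k; rewrite leq_eqVlt => /orP [/eqP ->|/aV ?]; exact/in_addP.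
Qed.

(** Taking [N - n] syzygies first reduces to [n]. The freedom in [N] lets bounds with different
    starting degrees be combined. *)
Lemma IT_category_resol m n : IT_category m n D -> exists U, forall N X, (n <= N)%N ->
  resol (@projective D) (add_res U m) N X.
Proof.
move=> /IT_categoryP [U HU]; exists U => N X /subnK <-.
elim: (N - n)%N X => [|j IH] X.
  have [K XK] := ex_syzygy abD epD n X; move: (HU _ _ XK) => UK.
  by apply: resol_impl XK => _ <-.
have [P [g [pP eg]]] := epD X; have [K [k sk]] := epi_ses abD eg.
by exists K, P, k, g; split.
Qed.

Lemma has_proj_res_pad n N X : (n <= N)%N -> has_proj_res n X ->
  resol (@projective D) (@projective D) N X.
Proof.
have pad j Y : projective Y -> resol (@projective D) (@projective D) j Y.
  elim: j Y => [|j IH] Y pY; first by exists Y; split=> //; exact: isomorphic_refl.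
  have [Z Z0] := abelian_zero abD; exists Z, Y, 0, (idmor Y).
  by split; [exact: ses_id|exact: pY|exact/IH/projective0].
move=> nN [V [d [a [rV pV]]]].
have {rV pV} : resol (@projective D) (@projective D) n X.
  apply/exact_resP => //; exists V, d, a; split=> //; last exact: pV.
  by move=> k /ltnW; exact: pV.
elim: n N X nN {V d a} => [|n IH] N X.
  by move=> _ [V [[f [g [gf fg]]] pV]]; apply/pad/(projective_retract fg pV).
case: N => // N nN [K [W [f [g [sfg pW HK]]]]].
by exists K, W, f, g; split=> //; exact: IH.
Qed.

End Extensions.

(** * Adjoint functors and recollements *)

Section Functors.
Variables C D : preaddCat.
Implicit Types (F : functor C D).

Definition additive_functor F : Prop :=
  forall (X Y : C) (f g : Mor X Y), fmor F (f + g) = fmor F f + fmor F g.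

Definition preserves_ses F : Prop :=
  forall (X Y Z : C) (f : Mor X Y) (g : Mor Y Z), ses f g -> ses (fmor F f) (fmor F g).

Lemma additive_functor0 F (X Y : C) : additive_functor F -> fmor F (0 : Mor X Y) = 0.
Proof. by move=> aF; apply: (addrI (fmor F 0)); rewrite -aF !addr0. Qed.

Lemma functor_addc F U X : additive_functor F -> addc U X -> addc (F U) (F X).
Proof.
move=> aF [s sE]; exists [seq (fmor F p.1, fmor F p.2) | p <- s].
rewrite -fmor1 sE big_map; elim: s {sE} => [|p s IH].
  by rewrite !big_nil additive_functor0.
by rewrite !big_cons aF fmorM IH.
Qed.

Lemma functor_isomorphic F X Y : isomorphic X Y -> isomorphic (F X) (F Y).
Proof.
by move=> [f [g [gf fg]]]; exists (fmor F f), (fmor F g); rewrite -!fmorM gf fg !fmor1.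
Qed.

Lemma functor_resol F (F1 E1 : C -> Prop) (F2 E2 : D -> Prop) m X :
  preserves_ses F -> (forall X, F1 X -> F2 (F X)) -> (forall X, E1 X -> E2 (F X)) ->
  resol F1 E1 m X -> resol F2 E2 m (F X).
Proof.
move=> sF FF EE; elim: m X => [|m IH] X /=.
  by move=> [V [/(functor_isomorphic F) ? /EE ?]]; exists (F V).
move=> [K [W [f [g [/sF sfg /FF FW /IH HK]]]]].
by exists (F K), (F W), (fmor F f), (fmor F g).
Qed.

Lemma functor_add_res F U m X : additive_functor F -> preserves_ses F ->
  add_res U m X -> add_res (F U) m (F X).
Proof.
by move=> aF sF; apply: functor_resol => // Y; exact: functor_addc.
Qed.

Lemma exact_functor_ses F : abelianCat C -> enough_projectives C ->
  abelianCat D -> enough_projectives D -> exact_functor F -> preserves_ses F.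
Proof.
by move=> abC epC abD epD eF X Y Z f g /short_exactP sfg; apply/short_exactP/eF/sfg.
Qed.

End Functors.

(** * Additivity and exactness of adjoint functors *)

Section Adjoint.
Variables C D : preaddCat.
Variables (L : functor C D) (G : functor D C).
Hypothesis adjLG : adjoint L G.

Lemma adjoint_nat : exists phi : forall (X : C) (Y : D), Mor (L X) Y -> Mor X (G Y),
  [/\ forall X Y, injective (@phi X Y),
      forall X Y (f : Mor X (G Y)), exists f', f = phi X Y f',
      forall X Y Y' (g : Mor Y Y') (h : Mor (L X) Y), phi X Y' (g \c h) = fmor G g \c phi X Y h
    & forall X X' Y (h : Mor (L X) Y) (f : Mor X' X),
        phi X' Y (h \c fmor L f) = phi X Y h \c f].
Proof.
have [phi [bphi nphi]] := adjLG; exists phi; split.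
- by move=> X Y; exact: bij_inj.
- by move=> X Y f; have [psi _ psiK] := bphi X Y; exists (psi f).
- move=> X Y Y' g h.
  by have := nphi X X Y Y' (idmor X) h g; rewrite fmor1 !compm1.
- move=> X X' Y h f.
  by have := nphi X X' Y Y f h (idmor Y); rewrite fmor1 !comp1m.
Qed.

Lemma left_adjoint_epi (X Y : C) (f : Mor X Y) : epi f -> epi (fmor L f).
Proof.
have [phi [iphi _ _ nr]] := adjoint_nat.
by move=> ef T g h /(congr1 (phi X T)); rewrite !nr => /ef/iphi.
Qed.

Lemma left_adjoint_projective (X : C) :
  (forall (Y Z : D) (g : Mor Y Z), epi g -> epi (fmor G g)) ->
  projective X -> projective (L X).
Proof.
have [phi [iphi sphi nl _]] := adjoint_nat.
move=> eG pX Y Z g f /eG eg; have [h hE] := pX _ _ _ (phi X Z f) eg.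
by have [h' h'E] := sphi _ _ h; exists h'; apply: iphi; rewrite nl -h'E.
Qed.

(** A left adjoint preserves zero objects and finite coproducts, hence biproducts; and [f + g]
    factors through the biproduct of two copies of [X]. *)
Lemma left_adjoint_additive : abelianCat C -> additive_functor L.
Proof.
have [phi [iphi sphi nl nr]] := adjoint_nat.
move=> abC; have L0 (X Y : C) : fmor L (0 : Mor X Y) = 0.
  have [Z Z0] := abelian_zero abC.
  have -> : (0 : Mor X Y) = (0 : Mor Z Y) \c (0 : Mor X Z) by rewrite compm0.
  have LZ : idmor (L Z) = 0.
    by apply: iphi; have [ZZ _] := Z0 (G (L Z)); rewrite (ZZ (phi _ _ 0)); exact: ZZ.
  by rewrite fmorM -(compm1 (fmor L 0)) LZ compm0 comp0m.
move=> X Y f g; have [S /is_dsum2P [i1 [i2 [p1 [p2 [E1 E2 E3 E4 E5]]]]]] := abelian_dsum abC X X.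
have joint T (a b : Mor (L S) T) : a \c fmor L i1 = b \c fmor L i1 ->
    a \c fmor L i2 = b \c fmor L i2 -> a = b.
  move=> /(congr1 (phi _ _)); rewrite !nr => ab1 /(congr1 (phi _ _)); rewrite !nr => ab2.
  by apply: iphi; rewrite -[LHS]compm1 -[RHS]compm1 -E5 !compmDr !compmA ab1 ab2.
have LE : idmor (L S) = fmor L i1 \c fmor L p1 + fmor L i2 \c fmor L p2.
  by apply: joint; rewrite comp1m compmDl -!compmA -!fmorM ?E1 ?E2 ?E3 ?E4
    !compm0 !compm1 !L0 ?addr0 ?add0r.
have -> : f + g = (f \c p1 + g \c p2) \c (i1 + i2).
  by rewrite compmDl !compmDr -!compmA E1 E2 E3 E4 !compm0 !compm1 add0r addr0.
rewrite fmorM -(compm1 (fmor L (_ + _))) LE compmDr compmDl !compmA -!fmorM.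
rewrite !(compmDl _ _ i1) !(compmDl _ _ i2) -!compmA E1 E2 E3 E4 !compm0 !compm1 add0r addr0.
by rewrite !compmDr E1 E2 E3 E4 !compm0 !compm1 add0r addr0.
Qed.

(** Left exactness follows by transposing generalised elements; preservation of epis supplies the
    rest. *)
Lemma right_adjoint_ses : additive_functor G ->
  (forall (Y Z : D) (g : Mor Y Z), epi g -> epi (fmor G g)) -> preserves_ses G.
Proof.
have [phi [iphi sphi nl _]] := adjoint_nat.
move=> aG eG X Y Z f g [mf gf fP eg].
have phi0 T W : phi T W 0 = 0.
  by rewrite -(comp0m _ (0 : Mor (L T) W)) nl additive_functor0 // comp0m.
split; last exact: eG.
- move=> T x; have [x' ->] := sphi _ _ x; rewrite -nl -(phi0 T Y) => /iphi/mf ->.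
  exact: phi0.
- by rewrite -fmorM gf additive_functor0.
- move=> T y; have [y' ->] := sphi _ _ y; rewrite -nl -(phi0 T Z) => /iphi/fP [x ->].
  by exists (phi _ _ x); rewrite nl.
Qed.

End Adjoint.

(** * Igusa-Todorov bounds from short exact and four-term sequences *)

Section Comparison.
Variable D : preaddCat.
Hypothesis abD : abelianCat D.
Hypothesis epD : enough_projectives D.

Lemma resol_add_res_ext a (U : D) : contains_proj U -> exists U',
  [/\ contains_proj U', addc U' U
    & forall N b (X Y Z : D) (i : Mor X Y) (p : Mor Y Z), ses i p ->
        resol (@projective D) (add_res U a) N X -> resol (@projective D) (add_res U b) N Z ->
        resol (@projective D) (add_res U' (a + b).+1) N Y].
Proof.
move=> bU; have [U' [bU' UU' HU']] := add_res_ext abD epD a bU.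
exists U'; split=> // N b X Y Z i p s HX HZ.
apply: resol_impl (resol_ext abD epD s HX HZ) => Y' [X' [Z' [i' [p' [s' HX' HZ']]]]].
exact: HU' s' HX' HZ'.
Qed.

Lemma resol_add_res_mono U U' m N (X : D) : addc U' U ->
  resol (@projective D) (add_res U m) N X -> resol (@projective D) (add_res U' m) N X.
Proof. by move=> UU'; apply: resol_impl => Y; exact: add_res_mono. Qed.

(** The hypothesis gives one good syzygy of each object, the conclusion concerns all of them; stable
    invariance bridges the gap. *)
Lemma IT_category_of_resol (U : D) m N : contains_proj U ->
  (forall X : D, resol (@projective D) (add_res U m) N X) -> IT_category m N D.
Proof.
move=> bU HU; apply/IT_categoryP => //; exists U => X K.
have XX := isomorphic_stable abD (isomorphic_refl X).
exact: (add_res_syzygies abD epD bU XX (HU X)).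
Qed.

Lemma common_generator (P U1 U2 : D) : contains_proj P -> exists U : D,
  [/\ contains_proj U, addc U U1 & addc U U2].
Proof.
move=> bP; have [V dV] := abelian_dsum abD U1 U2; have [U dU] := abelian_dsum abD P V.
have UV := addc_dsum2r dU; exists U; split.
- by move=> Q /bP; exact: addc_trans (addc_dsum2l dU).
- exact: addc_trans UV (addc_dsum2l dV).
- exact: addc_trans UV (addc_dsum2r dV).
Qed.

Section Bounds.
Variables (P U1 U2 : D) (m1 m2 n : nat) (small : D -> Prop).
Hypothesis bP : contains_proj P.
Hypothesis smallP : forall N Q, (n <= N)%N -> small Q ->
  resol (@projective D) (add_res U1 m1) N Q.

(** To be used with [small] the essential image of [i]. One extension costs the sum of both lengths
    plus one. *)
Lemma IT_category_ses :
  (forall X : D, exists L Q (f : Mor L X) (c : Mor X Q),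
     [/\ ses f c, small Q & resol (@projective D) (add_res U2 m2) n L]) ->
  IT_category (m2 + m1).+1 n D.
Proof.
move=> HX; have [U [bU UU1 UU2]] := common_generator U1 U2 bP.
have [U' [bU' UU' HU']] := resol_add_res_ext m2 bU.
apply: (IT_category_of_resol bU') => X; have [L [Q [f [c [sfc sQ HL]]]]] := HX X.
apply: HU' sfc (resol_add_res_mono UU2 HL) _.
exact: resol_add_res_mono UU1 (smallP (leqnn n) sQ).
Qed.

Lemma IT_category_four_term :
  (forall X : D, exists Z L J Q (z : Mor Z L) (u : Mor L J) (j : Mor J X) (c : Mor X Q),
     [/\ ses z u, ses j c, small Z, small Q
       & resol (@projective D) (add_res U2 m2) n.+1 L]) ->
  IT_category (m1.*2 + m2).+2 n.+1 D.
Proof.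
move=> HX; have [U [bU UU1 UU2]] := common_generator U1 U2 bP.
have [U' [bU' UU' HU']] := resol_add_res_ext m2 bU.
have [U'' [bU'' UU'' HU'']] := resol_add_res_ext (m2 + m1).+1 bU'.
have -> : (m1.*2 + m2).+2 = ((m2 + m1).+1 + m1).+1.
  by rewrite -addnn addSn -[in RHS]addnA [in RHS]addnC.
apply: (IT_category_of_resol bU'') => X.
have [Z [L [J [Q [z [u [j [c [szu sjc sZ sQ HL]]]]]]]]] := HX X.
have {}HL := resol_add_res_mono UU2 HL.
(* [Z] is the quotient of a first syzygy of [J], so it is resolved for [n] steps, whereas [Q] goes
   along with [J] for [n.+1]. *)
have HZ := resol_add_res_mono UU1 (smallP (leqnn n) sZ).
have HQ := resol_add_res_mono (addc_trans UU' UU1) (smallP (leqnSn n) sQ).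
apply: HU'' sjc _ HQ; have [K [W [k [g [sk pW HK]]]]] := HL.
have [K' [k' [a [b [sk' sab]]]]] := ses_rotate abD epD szu sk.
by exists K', W, k', (u \c g); split=> //; exact: HU' sab HK HZ.
Qed.

End Bounds.
End Comparison.

(** * Exactness properties of the recollement, and the transfer of resolutions *)

Section Recollement.
Variables (A B C : preaddCat).
Hypotheses (abA : abelianCat A) (abB : abelianCat B) (abC : abelianCat C).
Hypotheses (epA : enough_projectives A) (epB : enough_projectives B)
  (epC : enough_projectives C).
Variables (i : functor A B) (q p : functor B A) (e : functor B C) (l r : functor C B).
Hypothesis rec : recollement i q p e l r.
Hypothesis exl : exact_functor l.

Let le := recollement_le rec.
Let er := recollement_er rec.
Let qi := recollement_qi rec.
Let ip := recollement_ip rec.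

Lemma recollement_e_additive : additive_functor e.
Proof. exact: left_adjoint_additive er abB. Qed.

Lemma recollement_i_additive : additive_functor i.
Proof. exact: left_adjoint_additive ip abA. Qed.

Lemma recollement_l_additive : additive_functor l.
Proof. exact: left_adjoint_additive le abC. Qed.

(** [e] has adjoints on both sides: [l] gives left exactness and [r] preservation of epis. The
    argument for [i] is the same. *)
Lemma recollement_e_ses : preserves_ses e.
Proof.
apply: (right_adjoint_ses le recollement_e_additive) => Y Z g.
exact: left_adjoint_epi er _ _ _.
Qed.

Lemma recollement_i_ses : preserves_ses i.
Proof.
apply: (right_adjoint_ses qi recollement_i_additive) => Y Z g.
exact: left_adjoint_epi ip _ _ _.
Qed.

Lemma recollement_l_ses : preserves_ses l.
Proof. exact: exact_functor_ses. Qed.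

Lemma recollement_l_projective X : projective X -> projective (l X).
Proof.
by apply: (left_adjoint_projective le) => Y Z g; exact: left_adjoint_epi er _ _ _.
Qed.

(** The unit of an adjunction with fully faithful left adjoint is invertible: its inverse is the
    preimage under [l] of the transpose of the identity. *)
Lemma recollement_el_iso X : isomorphic (e (l X)) X.
Proof.
have [phi [iphi sphi _ nr]] := adjoint_nat le.
have [g' gK g'K] := recollement_l_ff rec (e (l X)) X.
pose eta := phi _ _ (idmor (l X)).
have phiE T (x : Mor T X) : phi _ _ (fmor l x) = eta \c x by rewrite -nr comp1m.
have [x' x'E] := sphi _ _ (idmor (e (l X))).
pose x := g' x'; have xE : eta \c x = idmor _ by rewrite -phiE /x g'K.
exists x, eta; split=> //.
have [h hK hhK] := recollement_l_ff rec X X.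
rewrite -[LHS]hK -[RHS]hK; congr (h _); apply: iphi.
by rewrite !phiE compmA xE comp1m compm1.
Qed.

(** [e] inverts the counit; the two clauses are the form used to show that [e] kills its kernel and
    cokernel. *)
Lemma recollement_counit X : exists eps : Mor (l (e X)) X,
  (forall T (x : Mor T (e (l (e X)))), fmor e eps \c x = 0 -> x = 0) /\
  exists y, fmor e eps \c y = idmor (e X).
Proof.
have [phi [iphi sphi nl nr]] := adjoint_nat le.
have [eps epsE] := sphi _ _ (idmor (e X)).
exists eps.
have epsP T (x : Mor T (e X)) : fmor e eps \c phi _ _ (fmor l x) = x.
  by rewrite -nl nr -epsE comp1m.
split; last by exists (phi _ _ (fmor l (idmor _))).
move=> T x; have [x' ->] := sphi _ _ x.
have [h hK hhK] := recollement_l_ff rec T (e X).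
rewrite -(hhK x') epsP => ->.
by rewrite (additive_functor0 _ _ recollement_l_additive) -(comp0m _ (idmor (l T))) nl
  (additive_functor0 _ _ recollement_e_additive) comp0m.
Qed.

Definition in_i (Y : B) : Prop := exists X, isomorphic (i X) Y.

Lemma recollement_four_term (X : B) : exists Z J Q (z : Mor Z (l (e X)))
    (u : Mor (l (e X)) J) (j : Mor J X) (c : Mor X Q),
  [/\ ses z u, ses j c, in_i Z & in_i Q].
Proof.
have [eps [ieps [y yE]]] := recollement_counit X.
have [J [Q [u [j [c [eu epsE sjc cc]]]]]] := ex_image abB eps.
have [Z [z szu]] := epi_ses abB eu.
exists Z, J, Q, z, u, j, c; split=> //; apply/(recollement_im_ker rec)/is_zeroP.
  have [mz _ _ _] := recollement_e_ses szu; apply: mz; rewrite compm1.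
  apply: ieps; rewrite -fmorM epsE -compmA; have [_ -> _ _] := szu.
  by rewrite compm0 (additive_functor0 _ _ recollement_e_additive).
have [_ _ _ ec] := recollement_e_ses sjc; apply: ec.
rewrite comp1m comp0m -(compm1 (fmor e c)) -yE compmA -fmorM; have [-> _] := cc.
by rewrite (additive_functor0 _ _ recollement_e_additive) comp0m.
Qed.

(* Since q l = 0, exactness of q makes the counit a monomorphism. *)
Lemma in_i_sub_le_zero (X : C) Z J (z : Mor Z (l X)) (u : Mor (l X) J) :
  exact_functor q -> ses z u -> in_i Z -> is_zero Z.
Proof.
move=> exq szu [A' iA]; have sq := exact_functor_ses abB epB abA epA exq.
have [mqz _ _ _] := sq _ _ _ _ _ szu.
have [phi [iphi sphi nl nr]] := adjoint_nat qi.
have [psi [ipsi spsi nlp nrp]] := adjoint_nat le.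
(* By adjunction a map from [l X] to [i A''] is a map from [X] to [e (i A'')], which is zero. *)
have hom0 A'' (x y : Mor (l X) (i A'')) : x = y.
  apply: ipsi; have /(recollement_im_ker rec) e0 : exists A1, isomorphic (i A1) (i A'').
    by exists A''; exact: isomorphic_refl.
  by have [_ e0'] := e0 X; rewrite (e0' (psi _ _ x)) (e0' (psi _ _ y)).
have ql0 : idmor (q (l X)) = 0 by apply: iphi; exact: hom0.
have qz0 : idmor (q Z) = 0.
  by apply: mqz; rewrite compm1 -(comp1m (fmor q z)) ql0 comp0m.
have [f [g [gf fg]]] := iA.
(* As [q Z] = 0, there is no nonzero map from [Z] to [i A'], although [Z] is isomorphic to
   [i A']. *)
have g0 : g = 0.
  have [g' ->] := sphi _ _ g; have [h hE] := sphi _ _ (0 : Mor Z (i A')).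
  by rewrite hE -(compm1 g') -(compm1 h) qz0 !compm0.
by apply: is_zeroP; rewrite -fg g0 compm0.
Qed.

(** [l] sends an [n]-th syzygy of [X] to one of [l X]. Resolve it over [U] in [B], apply the exact
    functor [e], and use that [e l] is isomorphic to the identity. *)
Lemma IT_category_recollement_quotient m n : IT_category m n B -> IT_category m n C.
Proof.
move=> /(IT_categoryP abB epB) [U HU]; apply/(IT_categoryP abC epC).
exists (e U) => X K XK; apply: (resol_iso (recollement_el_iso K)).
apply: (functor_add_res recollement_e_additive recollement_e_ses); apply: (HU (l X)).
by apply: functor_resol recollement_l_ses recollement_l_projective _ XK => Y <-.
Qed.

(** * Upper bounds for the middle category *)

Section UpperBounds.
Variables (P U1 : B) (m1 m2 n1 n2 : nat).
Hypothesis bP : contains_proj P.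
Hypothesis small_res : forall N X, (n1 <= N)%N ->
  resol (@projective B) (add_res U1 m1) N (i X).
Hypothesis ITC : IT_category m2 n2 C.

Let in_i_res N Y : (n1 <= N)%N -> in_i Y -> resol (@projective B) (add_res U1 m1) N Y.
Proof. by move=> nN [X XY]; exact: resol_iso XY (small_res X nN). Qed.

Lemma recollement_le_res : exists U2 : B, forall N (X : B), (n2 <= N)%N ->
  resol (@projective B) (add_res U2 m2) N (l (e X)).
Proof.
have [U2 HU2] := IT_category_resol abC epC ITC.
exists (l U2) => N X /(HU2 N (e X)).
apply: functor_resol recollement_l_ses recollement_l_projective _ => Y.
exact: functor_add_res recollement_l_additive recollement_l_ses.
Qed.

Lemma IT_category_recollement : exists n, IT_category (m1.*2 + m2).+2 n B.
Proof.
have [U2 HU2] := recollement_le_res.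
(* The maximum serves both families of resolutions; the extra step pays for passing from [J] to its
   syzygy. *)
exists (maxn n1 n2).+1; apply: (IT_category_four_term abB epB (U2 := U2) (P := P) bP).
  by move=> N Q nN; apply: in_i_res; exact: leq_trans (leq_maxl _ _) nN.
move=> X; have [Z [J [Q [z [u [j [c [szu sjc iZ iQ]]]]]]]] := recollement_four_term X.
exists Z, (l (e X)), J, Q, z, u, j, c; split=> //.
by apply: HU2; exact: leq_trans (leq_maxr _ _) (leqnSn _).
Qed.

Lemma IT_category_recollement_q_exact : exact_functor q ->
  exists n, IT_category (m1 + m2).+1 n B.
Proof.
move=> exq; have [U2 HU2] := recollement_le_res; rewrite addnC.
exists (maxn n1 n2); apply: (IT_category_ses abB epB (U2 := U2) (P := P) bP).
  by move=> N Q nN; apply: in_i_res; exact: leq_trans (leq_maxl _ _) nN.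
move=> X; have [Z [J [Q [z [u [j [c [szu sjc iZ iQ]]]]]]]] := recollement_four_term X.
(* The counit is now mono, so [l (e X)] itself takes the place of [J] and a single extension
   remains. *)
have Z0 := in_i_sub_le_zero exq szu iZ.
have [j' sjc'] := ses_iso_l sjc (ses_iso abB Z0 szu).
by exists (l (e X)), Q, j', c; split=> //; apply: HU2; exact: leq_maxr.
Qed.

End UpperBounds.

Lemma recollement_i_projective X : exact_functor p -> projective X -> projective (i X).
Proof.
move=> /(exact_functor_ses abB epB abA epA) sp.
apply: (left_adjoint_projective ip) => Y Z g /(epi_ses abB) [K [k /sp]].
by case.
Qed.

Lemma recollement_i_res m n : exact_functor p -> IT_category m n A ->
  exists U : B, forall N X, (n <= N)%N -> resol (@projective B) (add_res U m) N (i X).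
Proof.
move=> exp /(IT_category_resol abA epA) [U HU]; exists (i U) => N X /(HU N X).
apply: functor_resol recollement_i_ses (fun X => recollement_i_projective exp) _ => Y.
exact: functor_add_res recollement_i_additive recollement_i_ses.
Qed.

End Recollement.

(** * The distance as an extended real, and finite relative global dimension *)

Section Distance.
Variable R : realType.
Local Open Scope classical_set_scope.
Local Open Scope ereal_scope.

Lemma IT_dist_le (D : preaddCat) m n : IT_category m n D -> IT_dist R D <= m%:R%:E.
Proof. by move=> mn; apply: ereal_inf_lbound; exists m => //; exists n. Qed.

Lemma IT_dist_mono (D D' : preaddCat) :
  (forall m n, IT_category m n D -> IT_category m n D') -> IT_dist R D' <= IT_dist R D.
Proof.
by move=> DD'; apply/ereal_infP => _ [m [n mn] <-]; exact/IT_dist_le/DD'/mn.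
Qed.

(** A nonempty set of natural numbers attains its infimum, so a finite distance is realised by an
    actual pair. *)
Lemma IT_distP (D : preaddCat) : IT_dist R D = +oo \/
  exists m n, IT_category m n D /\ IT_dist R D = m%:R%:E.
Proof.
have [[m0 H0]|none] := pselect (exists m, exists n, IT_category m n D); last first.
  left; rewrite /IT_dist; set S := (X in ereal_inf X).
  suff -> : S = set0 by rewrite ereal_inf0.
  by rewrite -subset0 => x [m mn _]; apply: none; exists m.
right; have ex : exists m, `[< exists n, IT_category m n D >] by exists m0; apply/asboolP.
have [m /asboolP [n mn] mP] := ex_minnP ex.
exists m, n; split=> //; apply/eqP; rewrite eq_le (IT_dist_le mn) /=.
apply/ereal_infP => _ [k kn <-]; rewrite lee_fin ler_nat.
by apply: mP; apply/asboolP.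
Qed.

(** A finite supremum bounds all projective dimensions uniformly, so high syzygies can be chosen
    projective and thus lie in add(P). *)
Lemma finite_rel_gldim (A B : preaddCat) (abB : abelianCat B) (epB : enough_projectives B)
    (i : functor A B) (P : B) : contains_proj P -> rel_gldim R i < +oo ->
  exists n, forall N X, (n <= N)%N -> resol (@projective B) (add_res P 0) N (i X).
Proof.
move=> bP fin.
have [M MP] : exists M : nat, rel_gldim R i < M%:R%:E.
  move: fin; case: (rel_gldim R i) => [x _|//|_]; last by exists 0%N; rewrite ltNyr.
  exists (Num.bound `|x|%R); rewrite lte_fin.
  exact: le_lt_trans (ler_norm x) (archi_boundP (normr_ge0 x)).
exists M => N X MN.
have /ereal_inf_lt [_ [k kX <-]] : pd R (i X) < M%:R%:E.
  by apply: le_lt_trans MP; apply: ereal_sup_ubound; exists X.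
rewrite lte_fin ltr_nat => kM.
apply: resol_impl (has_proj_res_pad abB epB (ltnW (leq_trans kM MN)) kX) => Y pY.
exact/add_res0/bP.
Qed.

End Distance.

Local Open Scope ereal_scope.

Theorem theorem1p2 (R : realType) (A B C : preaddCat)
  (abA : abelianCat A) (abB : abelianCat B) (abC : abelianCat C)
  (epA : enough_projectives A) (epB : enough_projectives B) (epC : enough_projectives C)
  (i : functor A B) (q p : functor B A) (e : functor B C) (l r : functor C B)
  (rec : recollement i q p e l r)
  (P : B) (projP : projective P)
  (ProjB : forall X : B, projective X <-> in_add P X)
  (exl : exact_functor l) :
  (rel_gldim R i < +oo ->
     (IT_dist R C <= IT_dist R B <= IT_dist R C + 2%:E) /\
     (exact_functor q -> IT_dist R C <= IT_dist R B <= IT_dist R C + 1%:E))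
  /\
  (exact_functor p ->
     (IT_dist R C <= IT_dist R B <= 2%:E * IT_dist R A + IT_dist R C + 2%:E) /\
     (exact_functor q ->
        IT_dist R C <= IT_dist R B <= IT_dist R A + IT_dist R C + 1%:E)).
Proof.
have bP : contains_proj P by move=> Q /ProjB/(in_addP abB).
(* The chained inequalities are boolean conjunctions; rewriting their left half to [true] leaves
   only the upper bounds. *)
have -> : IT_dist R C <= IT_dist R B.
  by apply: IT_dist_mono => m n; exact: (IT_category_recollement_quotient abB abC epB epC rec exl).
have step1 U m1 m2 n1 n2 := IT_category_recollement abB abC epB epC rec exl
  (U1 := U) (m1 := m1) (m2 := m2) (n1 := n1) (n2 := n2) bP.
have step2 U m1 m2 n1 n2 := IT_category_recollement_q_exact abA abB abC epA epB epC rec exl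
  (U1 := U) (m1 := m1) (m2 := m2) (n1 := n1) (n2 := n2) bP.
split=> [/(finite_rel_gldim abB epB bP) [n1 res1]|exp] /=.
  have [->|[m [n [mn ->]]]] := IT_distP R C; first by split; rewrite addye ?leey.
  split.
    (* Here [m1] = 0, so the general bound [m1.*2 + m2 + 2] becomes [m + 2], and for exact [q] the
       other becomes [m + 1]. *)
    have [N HN] := step1 _ _ _ _ _ res1 mn.
    by apply: le_trans (IT_dist_le R HN) _; rewrite -EFinD lee_fin -natrD ler_nat addn2.
  move=> exq; have [N HN] := step2 _ _ _ _ _ res1 mn exq.
  by apply: le_trans (IT_dist_le R HN) _; rewrite -EFinD lee_fin -natr1.
have [->|[a [n1 [an1 ->]]]] := IT_distP R A.
  (* With an infinite distance for [A] the bounds are +oo, provided the other summand is not -oo,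
     which would absorb it. *)
  have C0 : IT_dist R C != -oo.
    by have [->|[m [n [_ ->]]]] := IT_distP R C.
  by split; rewrite ?gt0_muley ?lte_fin ?ltr0n // !addye ?leey.
have [U res1] := recollement_i_res abA abB epA epB rec exp an1.
have [->|[m [n [mn ->]]]] := IT_distP R C; first by split; rewrite -?EFinM addey // addye ?leey.
split.
  have [N HN] := step1 _ _ _ _ _ res1 mn.
  apply: le_trans (IT_dist_le R HN) _; rewrite -EFinM -!EFinD lee_fin -natrM -!natrD ler_nat.
  by rewrite -muln2 mulnC addn2.
move=> exq; have [N HN] := step2 _ _ _ _ _ res1 mn exq.
by apply: le_trans (IT_dist_le R HN) _; rewrite -!EFinD lee_fin -natrD natr1.
Qed.
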